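(* Let $p,q\in\mathbb{N}$ be co-prime and $\theta=\tan^{-1}(p/q)$. Then $$1>\dim(\mu_\theta)\ge\log 9-\frac{P(l_{pq},T|_{l_{pq}},\phi)}{\log 2}.$$
   Context: Let $D=\{0,1,p/q\}$ with $p/q\in[0,1]$. $\mu_\theta$ is the unique Borel probability measure on $\mathbb{R}$ with $\mu_\theta(A)=\tfrac13(\mu_\theta(2A)+\mu_\theta(2A-1)+\mu_\theta(2A-p/q))$, i.e. the law of $\sum_{i\ge1}a_i2^{-i}$ with $a_i$ i.i.d. uniform on $D$; $\dim(\mu_\theta)$ is its (Hausdorff) dimension as a measure. Let $B=\{(0,0),(1,0),(0,1),(1,1)\}$, ordered in this way to index rows/columns $1,\dots,4$, and define $A_{(0,0)}=\begin{pmatrix}3&1&1&1\\0&1&0&0\\0&0&1&0\\0&0&0&1\end{pmatrix}$, $A_{(1,0)}=\begin{pmatrix}1&0&1&0\\1&3&0&1\\0&0&0&0\\0&0&1&1\end{pmatrix}$, $A_{(0,1)}=\begin{pmatrix}1&1&0&0\\0&0&0&0\\1&0&3&1\\0&1&0&1\end{pmatrix}$, $A_{(1,1)}=\begin{pmatrix}1&0&0&0\\0&1&0&0\\0&0&1&0\\1&1&1&3\end{pmatrix}$. For $z\in B^{\mathbb{N}}$, $\phi(z)=\limsup_{n\to\infty}\log\frac{(1,1,1,1)A_{z_1}\cdots A_{z_n}(1,0,0,0)^T}{(1,1,1,1)A_{z_2}\cdots A_{z_n}(1,0,0,0)^T}$. For a word $\omega$ over $B$, $\pi(\omega)=\sum_i\omega_i2^{-i}\in\mathbb{R}^2$.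 The extended line is $l_{pq}=\{(x,y):\exists x',y',\ x\equiv x',y\equiv y'\pmod1,\ \tfrac pq x'=y'\}$; $X^n_\theta=\{x\in B^n:\pi(x)\in l_{pq}\}$, $X^{\mathbb{N}}_\theta=\{\omega\in B^{\mathbb{N}}:\pi(\omega)\in l_{pq}\}$, $\sigma$ the left shift, and $[i_1\cdots i_n]$ the set of $\omega\in X^{\mathbb{N}}_\theta$ beginning with $i_1\cdots i_n$. The pressure of $\phi$ for the doubling map $T(x,y)=(2x\bmod 1,2y\bmod1)$ restricted to $l_{pq}$ (coded by $\sigma$ on $X^{\mathbb{N}}_\theta$) is $$P(l_{pq},T|_{l_{pq}},\phi)=\lim_{n\to\infty}\frac1n\log\Big(\sum_{i_1\cdots i_n\in X^n_\theta}\exp\Big(\sup_{\omega\in[i_1\cdots i_n]}\sum_{j=0}^{n-1}\phi(\sigma^j\omega)\Big)\Big).$$ *)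

(* Defs.v *)
From HB Require Import structures.
From mathcomp Require Import all_boot all_order all_algebra.
From mathcomp Require Import all_classical all_reals all_analysis.

Set Implicit Arguments.
Unset Strict Implicit.
Unset Printing Implicit Defensive.

Import Order.TTheory GRing.Theory Num.Theory.
Import numFieldNormedType.Exports.

Local Open Scope classical_set_scope.
Local Open Scope ring_scope.

Section Defs.
Variable R : realType.

Definition diam (U : set R) : \bar R :=
  if `[< U = set0 >] then 0%E
  else ereal_sup [set (`|x.1 - x.2|)%:E | x in U `*` U].

Definition hcontent (s : R) (U : set R) : \bar R :=
  if `[< U = set0 >] then 0%E else poweR (diam U) s.

Definition hausdorff_delta (s delta : R) (A : set R) : \bar R :=
  ereal_inf [set (\sum_(0 <= i <oo) hcontent s (U i))%E
            | U in [set U : nat -> set R |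
                    A `<=` \bigcup_i U i /\ forall i, (diam (U i) <= delta%:E)%E]].

Definition hausdorff_measure (s : R) (A : set R) : \bar R :=
  ereal_sup [set hausdorff_delta s delta A | delta in [set d : R | 0 < d]].

Definition hausdorff_dim (A : set R) : \bar R :=
  ereal_inf [set s%:E | s in [set s : R | 0 <= s /\ hausdorff_measure s A = 0%E]].

Definition measure_dim (mu : set R -> \bar R) : \bar R :=
  ereal_inf [set hausdorff_dim A | A in [set A : set R | measurable A /\ mu A = 1%E]].

Definition self_similar_pq (p q : nat) (mu : set R -> \bar R) : Prop :=
  forall A : set R, measurable A ->
    mu A = ((1 / 3 : R)%:E *
            (mu [set (2 * a)%R | a in A]
             + mu [set (2 * a - 1)%R | a in A]
             + mu [set (2 * a - p%:R / q%:R)%R | a in A]))%E.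

(* B = {(0,0),(1,0),(0,1),(1,1)}; a digit is (x-digit, y-digit) *)
Definition digit := (bool * bool)%type.

Definition digit_idx (b : digit) : 'I_4 :=
  match b with
  | (false, false) => inord 0
  | (true, false) => inord 1
  | (false, true) => inord 2
  | (true, true) => inord 3
  end.

Definition mx4 (l : seq (seq R)) : 'M[R]_4 :=
  \matrix_(i < 4, j < 4) nth 0 (nth [::] l i) j.

Definition Amat (b : digit) : 'M[R]_4 :=
  match b with
  | (false, false) => mx4 [:: [:: 3; 1; 1; 1]; [:: 0; 1; 0; 0];
                             [:: 0; 0; 1; 0]; [:: 0; 0; 0; 1]]
  | (true, false)  => mx4 [:: [:: 1; 0; 1; 0]; [:: 1; 3; 0; 1];
                             [:: 0; 0; 0; 0]; [:: 0; 0; 1; 1]]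
  | (false, true)  => mx4 [:: [:: 1; 1; 0; 0]; [:: 0; 0; 0; 0];
                             [:: 1; 0; 3; 1]; [:: 0; 1; 0; 1]]
  | (true, true)   => mx4 [:: [:: 1; 0; 0; 0]; [:: 0; 1; 0; 0];
                             [:: 0; 0; 1; 0]; [:: 1; 1; 1; 3]]
  end.

(* (1,1,1,1) A_{z_{m+1}} ... A_{z_n} (1,0,0,0)^T, for z : nat -> digit with
   z_k (1-based) = z (k-1) *)
Definition word_weight (z : nat -> digit) (m n : nat) : R :=
  (const_mx 1 *m (\prod_(m <= i < n) Amat (z i)) *m delta_mx 0 0 : 'M[R]_1) 0 0.

Definition phi (z : nat -> digit) : R :=
  limn_sup (fun n => ln (word_weight z 0 n / word_weight z 1 n)).

Definition shift (z : nat -> digit) : nat -> digit := fun i => z i.+1.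

Definition pi_inf (w : nat -> digit) : R * R :=
  (limn (fun n => \sum_(0 <= i < n) ((w i).1%:R / 2 ^+ i.+1 : R)),
   limn (fun n => \sum_(0 <= i < n) ((w i).2%:R / 2 ^+ i.+1 : R))).

Definition pi_fin (n : nat) (w : {ffun 'I_n -> digit}) : R * R :=
  (\sum_(i < n) ((w i).1%:R / 2 ^+ i.+1),
   \sum_(i < n) ((w i).2%:R / 2 ^+ i.+1)).

Definition congr1 (x x' : R) : Prop := exists k : int, x - x' = k%:~R.

Definition lpq (p q : nat) (xy : R * R) : Prop :=
  exists x' y' : R, congr1 xy.1 x' /\ congr1 xy.2 y' /\ p%:R / q%:R * x' = y'.

Definition XN (p q : nat) : set (nat -> digit) := [set w | lpq p q (pi_inf w)].

Definition cylinder (p q n : nat) (w : {ffun 'I_n -> digit}) : set (nat -> digit) :=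
  [set om | XN p q om /\ forall i : 'I_n, om i = w i].

Definition birkhoff (n : nat) (om : nat -> digit) : R :=
  \sum_(0 <= j < n) phi (iter j shift om).

Definition pressure_seq (p q : nat) (n : nat) : R :=
  n%:R^-1 * ln (\sum_(w : {ffun 'I_n -> digit} | `[< lpq p q (pi_fin w) >])
                  expR (sup [set birkhoff n om | om in cylinder p q w])).

Definition pressure (p q : nat) : R := limn (pressure_seq p q).

End Defs.

(* Main.v *)
Require Import Defs.
From HB Require Import structures.
From mathcomp Require Import all_boot all_order all_algebra.
From mathcomp Require Import all_classical all_reals all_analysis.
From mathcomp Require Import measurable_realfun ring lra zify.

(** Write [X_n] for the random integer [sum_i a_i 2^(n-1-i)], with [a_i] uniform
    in [{p, 0, q}]: the [mu]-mass of the cells of side [2^-n/q], folded modulo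
    [2^n], is an average of translates of the law of [X_n mod 2^n].

    Lower bound.  The first entry of the row vector [(1,1,1,1) A_{z_1} ... A_{z_n}]
    counts the pairs of gasket words whose difference is [pi(z_1 ... z_n)] modulo
    [Z^2], so summing it over [X^n_theta] counts the pairs with
    [X_n = X'_n mod 2^n].  The matrices contract the ratios of neighbouring
    entries by 3/4, which makes [phi] a uniform geometric limit and the Birkhoff
    sums equal to [ln (word_weight)] up to a bounded error.  The collision counts
    are submultiplicative, hence [ln 9 - pressure] is the exponential rate of the
    collision probability (L^2 dimension), and this bounds the dimension from
    below by the mass distribution principle.

    Upper bound.  Given the low bits of [X_n], the carry has some law [pi] on
    [{0..q}].  The law of the next [L] bits is never close to uniform, uniformly
    in [pi]: its Fourier coefficient at [2 pi / 2^L] is that of [pi], which has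
    positive real part, times a product of factors [1 + e^{ipt} + e^{iqt}] with
    [t] a dyadic angle, none of which vanishes.  So the L^{1/2} norm of the law of
    [X_n mod 2^n] is exponentially smaller than for the uniform law, and [mu] lives
    on exponentially fewer than [2^n] cells. *)

Set Implicit Arguments.
Unset Strict Implicit.
Unset Printing Implicit Defensive.

Import Order.TTheory GRing.Theory Num.Theory.
Import numFieldNormedType.Exports.
Local Open Scope classical_set_scope.
Local Open Scope ring_scope.

(** * Words modulo powers of two *)

(** The values of all words of length [n], with multiplicity, leading digit first. A general
    [zmodType] covers both the integer digit sums and the gasket words in pairs of integers. *)
Definition vals (V : zmodType) (ds : seq V) n : seq V :=
  iter n (fun s => [seq x *+ 2 + d | x <- s, d <- ds]) [:: 0].

Section counting.
Variable R : realType.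
Implicit Types (n m : nat) (x y k j : int).

Lemma big_vals0 (V : zmodType) (ds : seq V) (F : V -> R) :
  \sum_(x <- vals ds 0) F x = F 0.
Proof. by rewrite /vals /= big_seq1. Qed.

Lemma big_valsS (V : zmodType) (ds : seq V) n (F : V -> R) :
  \sum_(x <- vals ds n.+1) F x =
  \sum_(x <- vals ds n) \sum_(d <- ds) F (x *+ 2 + d).
Proof. by rewrite /vals iterS big_allpairs_dep. Qed.

Lemma big_vals_cat (V : zmodType) (ds : seq V) m n (F : V -> R) :
  \sum_(x <- vals ds (m + n)) F x =
  \sum_(x <- vals ds m) \sum_(y <- vals ds n) F (x *+ (2 ^ n) + y).
Proof.
elim: n F => [|n IH] F.
  by rewrite addn0; apply: eq_bigr => x _; rewrite big_vals0 expn0 addr0 mulr1n.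
rewrite addnS big_valsS IH; apply: eq_bigr => x _.
rewrite big_valsS; apply: eq_bigr => y _; apply: eq_bigr => d _.
by rewrite mulrnDl -addrA expnSr mulrnA.
Qed.

Lemma size_vals (V : zmodType) (ds : seq V) n :
  size (vals ds n) = (size ds ^ n)%N.
Proof.
elim: n => [|n IH] //; rewrite /vals iterS size_allpairs -/(vals ds n) IH.
by rewrite expnSr.
Qed.

Lemma Posz_exp2 n : (2 ^ n)%N%:Z = 2 ^+ n.
Proof. by rewrite -natz natrX. Qed.

Definition pow2_dvd n x : R := ((2 ^+ n : int) %| x)%Z%:R.

Lemma ind_ge0 n x : 0 <= pow2_dvd n x. Proof. exact: ler0n. Qed.

Lemma ind0 x : pow2_dvd 0 x = 1. Proof. by rewrite /pow2_dvd expr0 dvd1z. Qed.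

Lemma indN n x : pow2_dvd n (- x) = pow2_dvd n x.
Proof. by rewrite /pow2_dvd rpredN. Qed.

Lemma ind_subst n x y c : (2 ^+ n %| x - y)%Z -> pow2_dvd n (x + c) = pow2_dvd n (y + c).
Proof.
move=> h; rewrite /pow2_dvd.
rewrite -[x](subrK y) -addrA rpredDl //.
Qed.

Lemma ind_mulD n x y : pow2_dvd n x * pow2_dvd n (x + y) = pow2_dvd n x * pow2_dvd n y.
Proof.
rewrite /pow2_dvd; case: (boolP (_ %| x)%Z) => h; last by rewrite !mul0r.
by rewrite rpredDl.
Qed.

Lemma ind_double n x : pow2_dvd n.+1 (x *+ 2) = pow2_dvd n x.
Proof. by rewrite /pow2_dvd -[x *+ 2]mulr_natr exprSr dvdz_mul2r. Qed.

Lemma ind_odd n x y : ~~ (2 %| y)%Z -> pow2_dvd n.+1 (x *+ 2 + y) = 0.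
Proof.
move=> h; rewrite /pow2_dvd; case: (boolP (_ %| _)%Z) => //= h2; exfalso.
move/negP: h; apply.
have h3 : (2 %| x *+ 2 + y)%Z by apply: dvdz_trans h2; rewrite exprS dvdz_mulr.
by rewrite -(rpredDl y (x := x *+ 2)) // -[x *+ 2]mulr_natr dvdz_mull.
Qed.

Lemma ind_step n x y : pow2_dvd n.+1 (x *+ 2 + y) =
  if (2 %| y)%Z then pow2_dvd n (x + (y %/ 2)%Z) else 0.
Proof.
case: ifPn => h; last exact: ind_odd.
by rewrite -[in LHS](divzK h) mulr_natr -mulrnDl ind_double.
Qed.

(** The quotient of [y] by [2 ^+ n] is the carry from the low [n] bits into the high [m] bits. *)
Lemma ind_cat m n x y : pow2_dvd (m + n) (x *+ (2 ^ n) + y) =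
  pow2_dvd n y * pow2_dvd m (x + (y %/ (2 ^+ n))%Z).
Proof.
rewrite /pow2_dvd -natrM mulnb; congr (_%:R); congr nat_of_bool.
have e : x *+ (2 ^ n) = x * 2 ^+ n :> int by rewrite -[LHS]mulr_natr natrX.
case: (boolP (_ %| y)%Z) => h /=.
  by rewrite -[in LHS](divzK h) e -mulrDl exprD dvdz_mul2r // expf_eq0 andbF.
apply/negP => h2; move/negP: h; apply.
rewrite -(rpredDl y (x := x *+ (2 ^ n))); last by rewrite e dvdz_mull.
by apply: dvdz_trans h2; rewrite exprD dvdz_mull.
Qed.

(** A partition of unity: multiplying by it turns sums over words into sums over residue classes. *)
Lemma sum_ind n x : \sum_(j < 2 ^ n) pow2_dvd n (x - j%:Z) = 1.
Proof.
have N0 : (2 ^+ n : int) != 0 by rewrite expf_eq0 andbF.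
have hr0 := modz_ge0 x N0.
have hr1 : (x %% (2 ^+ n))%Z < (2 ^ n)%N%:Z.
  by rewrite Posz_exp2 ltz_pmod ?exprn_gt0.
have hlt : (`|(x %% (2 ^+ n))%Z| < 2 ^ n)%N by lia.
have hd : (Ordinal hlt : nat)%:Z = (x %% (2 ^+ n))%Z by rewrite /=; lia.
rewrite (bigD1 (Ordinal hlt)) //= big1 ?addr0.
  by rewrite /pow2_dvd -eqz_mod_dvd hd modz_mod eqxx.
move=> i ni; rewrite /pow2_dvd -eqz_mod_dvd [(i%:Z %% _)%Z]modz_small; last first.
  by rewrite -Posz_exp2; apply/andP; split=> //; have := ltn_ord i; lia.
case: eqP => //= h; exfalso; move/eqP: ni; apply; apply: val_inj => /=.
by rewrite h.
Qed.

Variable ds : seq int.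

Definition residue_count n j : R := \sum_(x <- vals ds n) pow2_dvd n (x - j).

(** The autocorrelation of [residue_count] at lag [k], by [sum_gammaM]; lag 0 counts the colliding
    pairs. *)
Definition corr n k : R :=
  \sum_(x <- vals ds n) \sum_(y <- vals ds n) pow2_dvd n (x - y - k).

Lemma gamma_ge0 n j : 0 <= residue_count n j.
Proof. by apply: sumr_ge0 => x _; exact: ind_ge0. Qed.

Lemma sum_gamma n k : \sum_(j < 2 ^ n) residue_count n (j%:Z - k) = (size ds ^ n)%:R.
Proof.
rewrite exchange_big /=.
rewrite (eq_bigr (fun=> 1)) => [|x _].
  by rewrite big_tnth sumr_const card_ord size_vals.
rewrite -(sum_ind n (x + k)); apply: eq_bigr => j _; congr pow2_dvd; ring.
Qed.

Lemma sum_gammaM n k l c : c = k - l ->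
  \sum_(j < 2 ^ n) residue_count n (j%:Z + k) * residue_count n (j%:Z + l) = corr n c.
Proof.
move=> ->.
rewrite (eq_bigr (fun j : 'I_(2 ^ n) => \sum_(x <- vals ds n) \sum_(y <- vals ds n)
   pow2_dvd n (x - (j%:Z + k)) * pow2_dvd n (y - (j%:Z + l)))); last first.
  by move=> j _; rewrite /residue_count big_distrlr.
rewrite exchange_big; apply: eq_bigr => x _ /=.
rewrite exchange_big; apply: eq_bigr => y _ /=.
rewrite -[RHS]mulr1 -(sum_ind n (y - l)) mulr_sumr; apply: eq_bigr => j _.
rewrite mulrC (_ : y - (j%:Z + l) = y - l - j%:Z); last by ring.
rewrite (_ : x - (j%:Z + k) = (y - l - j%:Z) + (x - y - (k - l))); last by ring.
by rewrite ind_mulD mulrC.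
Qed.

(** An autocorrelation peaks at lag 0: sum [2ab <= a^2 + b^2] over the residues. Both sums of
    squares equal [corr n 0], since a shift permutes the residues. *)
Lemma corr_le n k : corr n k <= corr n 0.
Proof.
have h0 : \sum_(j < 2 ^ n) residue_count n (j%:Z + 0) ^+ 2 = corr n 0.
  by rewrite -(@sum_gammaM n 0 0) ?subrr //; apply: eq_bigr => j _; rewrite expr2.
have hk : \sum_(j < 2 ^ n) residue_count n (j%:Z + k) ^+ 2 = corr n 0.
  by rewrite -(@sum_gammaM n k k) ?subrr //; apply: eq_bigr => j _; rewrite expr2.
rewrite -(@sum_gammaM n k 0) ?subr0 //.
have : \sum_(j < 2 ^ n) (residue_count n (j%:Z + k) * residue_count n (j%:Z + 0)) *+ 2 <=
  \sum_(j < 2 ^ n) (residue_count n (j%:Z + k) ^+ 2 + residue_count n (j%:Z + 0) ^+ 2).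
  apply: ler_sum => j _.
  have := sqr_ge0 (residue_count n (j%:Z + k) - residue_count n (j%:Z + 0)).
  by rewrite sqrrB; lra.
by rewrite sumrMnl big_split /= h0 hk -mulr2n ler_pMn2r.
Qed.

Lemma sum_gamma2 n k : \sum_(j < 2 ^ n) residue_count n (j%:Z - k) ^+ 2 = corr n 0.
Proof.
by rewrite -(@sum_gammaM n (- k) (- k)) ?subrr.
Qed.

Lemma corr0 k : corr 0 k = 1.
Proof. by rewrite /corr !big_vals0 ind0. Qed.

Lemma corrS n k : corr n.+1 k = \sum_(d <- ds) \sum_(e <- ds)
  if (2 %| k - d + e)%Z then corr n ((k - d + e) %/ 2)%Z else 0.
Proof.
rewrite /corr big_valsS [LHS]exchange_big; apply: eq_bigr => d _ /=.
under eq_bigr => x _ do rewrite big_valsS exchange_big /=.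
rewrite exchange_big; apply: eq_bigr => e _ /=.
case: ifPn => h; last first.
  rewrite big1 // => x _; rewrite big1 // => y _.
  rewrite (_ : _ - _ = (x - y) *+ 2 + (d - e - k)); last by ring.
  rewrite ind_odd //; apply: contra h => h; rewrite (_ : _ + e = - (d - e - k)) ?rpredN //; ring.
apply: eq_bigr => x _; apply: eq_bigr => y _.
rewrite (_ : _ - k = (x - y) *+ 2 - (k - d + e)); last by ring.
by rewrite -[in LHS](divzK h) mulr_natr -mulrnBl ind_double.
Qed.

(** The induction needs all lags because [corrS] replaces the lag by a carry; [corr_le] absorbs the
    lag that is left once [m] digits have been stripped. *)
Lemma corrD m n k : corr (m + n) k <= corr m k * corr n 0.
Proof.
elim: m k => [|m IH] k; first by rewrite corr0 mul1r corr_le.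
rewrite addSn !corrS mulr_suml; apply: ler_sum => d _.
rewrite mulr_suml; apply: ler_sum => e _.
by case: ifP => _; rewrite ?mul0r.
Qed.

(** Given the low residue [j], the high bits are those of an independent word, translated by the
    carry out of the low bits. *)
Lemma gamma_cat m n i j : residue_count (m + n) (j + i *+ (2 ^ n)) =
  \sum_(x <- vals ds n) pow2_dvd n (x - j) * residue_count m (i - ((x - j) %/ (2 ^+ n))%Z).
Proof.
rewrite /residue_count big_vals_cat exchange_big; apply: eq_bigr => x _ /=.
rewrite mulr_sumr; apply: eq_bigr => y _.
rewrite (_ : _ - _ = (y - i) *+ (2 ^ n) + (x - j)); last by rewrite mulrnBl; ring.
rewrite ind_cat; congr (_ * pow2_dvd _ _); ring.
Qed.

Lemma corr_gt0 n : 0 \in ds -> 1 <= corr n 0.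
Proof.
move=> h0; have hv : 0 \in vals ds n.
  elim: n => [|n IH]; first by rewrite inE.
  rewrite /vals iterS; apply/allpairsP; exists (0, 0).
  by split=> //=; rewrite mul0rn addr0.
rewrite /corr (big_rem 0) //= (big_rem 0) //= !subrr -addrA.
rewrite -[1]addr0 lerD //; first by rewrite /pow2_dvd dvdz0.
apply: addr_ge0; first by apply: sumr_ge0 => x _; exact: ind_ge0.
by apply: sumr_ge0 => x _; apply: sumr_ge0 => y _; exact: ind_ge0.
Qed.

End counting.

(** * Contraction of the transfer matrices *)

Section transfer.
Variable R : realType.
Implicit Types (b c : digit) (g h : digit -> R) (z : nat -> digit).

(* Right multiplication by [Amat b] is a subdivision of the triangular lattice
   with edges (1,0), (0,1), (1,1): the entry at a subdivided vertex is three times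
   the old one, the entry at the midpoint of an edge is the sum of the entries at
   its ends [lo] and [hi]. *)
Definition lo b c : digit :=
  if (b.1 != c.1) && (b.2 != c.2) then (false, false) else b.
Definition hi b c : digit :=
  if (b.1 != c.1) && (b.2 != c.2) then (true, true) else c.

Definition step b g c : R :=
  if b == c then 3 * g b else g (lo b c) + g (hi b c).

(* All pairs except the diagonal {(1,0), (0,1)}, which the triangulation omits. *)
Definition edge c c' := [|| c.1 == c'.1, c.2 == c'.2 | c.1 == c.2].

Lemma sum_I4 (F : 'I_4 -> R) : \sum_(k < 4) F k =
  F (inord 0) + F (inord 1) + F (inord 2) + F (inord 3).
Proof.
rewrite !big_ord_recl big_ord0 addr0 !addrA.
by congr (F _ + F _ + F _ + F _); apply: val_inj; rewrite /= inordK.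
Qed.

Lemma mulmx_Amat (v : 'rV[R]_4) b c :
  (v *m Amat R b) 0 (digit_idx c) = step b (fun c => v 0 (digit_idx c)) c.
Proof.
rewrite mxE sum_I4 /step /lo /hi.
by case: b => -[] []; case: c => -[] [] /=; rewrite /mx4 !mxE !inordK //=; ring.
Qed.

Lemma edgeC c c' : edge c c' = edge c' c.
Proof. by case: c c' => -[] [] [[] []]. Qed.

Section contraction.
Variables (g h : digit -> R) (D : R).
Hypothesis h_gt0 : forall c, 0 < h c.
Hypothesis h_ratio : forall c c', edge c c' -> h c <= 3 * h c'.
Hypothesis osc : forall c c', edge c c' -> `|g c / h c - g c' / h c'| <= D.

Let mid P Q := (g P + g Q) / (h P + h Q).

Let midC P Q : mid P Q = mid Q P.
Proof. by rewrite /mid addrC [X in _ / X]addrC. Qed.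

(** [mid P Q] is a convex combination of the ratios at [P] and [Q] whose weights, by [h_ratio], lie
    between 1/4 and 3/4. The difference of the two combinations splits into ratio differences whose
    coefficients add up to one minus the smaller weight of [Q]. *)
Lemma osc_mid P Q S : edge P Q -> edge Q S -> edge P S ->
  `|mid P Q - mid Q S| <= 3 / 4 * D.
Proof.
move=> PQ QS PS; rewrite /mid.
have hP := h_gt0 P; have hQ := h_gt0 Q; have hS := h_gt0 S.
have r1 := h_ratio PQ; have r2 := h_ratio QS; have r3 := h_ratio PS.
have r1' : h Q <= 3 * h P by apply: h_ratio; rewrite edgeC.
have r2' : h S <= 3 * h Q by apply: h_ratio; rewrite edgeC.
have xPQ := osc PQ; have xQS := osc QS; have xPS := osc PS.
set xP := g P / h P in xPQ xPS; set xQ := g Q / h Q in xPQ xQS.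
set xS := g S / h S in xQS xPS.
have D0 : 0 <= D by apply: le_trans xPQ.
pose a := h Q / (h P + h Q); pose b := h Q / (h Q + h S).
have a1 : 1 / 4 <= a by rewrite ler_pdivlMr; lra.
have a2 : a <= 3 / 4 by rewrite ler_pdivrMr; lra.
have b1 : 1 / 4 <= b by rewrite ler_pdivlMr; lra.
have b2 : b <= 3 / 4 by rewrite ler_pdivrMr; lra.
have -> : (g P + g Q) / (h P + h Q) = a * xQ + (1 - a) * xP.
  by rewrite /a /xQ /xP; field; rewrite !gt_eqF //; lra.
have -> : (g Q + g S) / (h Q + h S) = b * xQ + (1 - b) * xS.
  by rewrite /b /xQ /xS; field; rewrite !gt_eqF //; lra.
have scale k x : 0 <= k -> `|x| <= D -> `|k * x| <= k * D.
  by move=> k0 xD; rewrite normrM ger0_norm // ler_wpM2l.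
have [ab|ba] := leP a b.
  rewrite (_ : _ - _ = (1 - b) * (xP - xS) + (b - a) * (xP - xQ)); last by ring.
  apply: le_trans (ler_normD _ _) _.
  have := scale (1 - b) _ ltac:(lra) xPS; have := scale (b - a) _ ltac:(lra) xPQ.
  have : (1 - a) * D <= 3 / 4 * D by rewrite ler_wpM2r //; lra.
  by lra.
rewrite (_ : _ - _ = (1 - a) * (xP - xS) + (a - b) * (xQ - xS)); last by ring.
apply: le_trans (ler_normD _ _) _.
have := scale (1 - a) _ ltac:(lra) xPS; have := scale (a - b) _ ltac:(lra) xQS.
have : (1 - b) * D <= 3 / 4 * D by rewrite ler_wpM2r //; lra.
by lra.
Qed.

Lemma step_gt0 b c : 0 < step b h c.
Proof.
have h1 := h_gt0; rewrite /step; case: ifP => _; first by rewrite mulr_gt0.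
by rewrite addr_gt0.
Qed.

Lemma step_ratio b c c' : edge c c' -> step b h c <= 3 * step b h c'.
Proof.
have h1 := h_gt0 (false, false); have h2 := h_gt0 (true, false).
have h3 := h_gt0 (false, true); have h4 := h_gt0 (true, true).
have e := @h_ratio.
have e1 := e (false, false) (true, false) isT.
have e2 := e (true, false) (false, false) isT.
have e3 := e (false, false) (false, true) isT.
have e4 := e (false, true) (false, false) isT.
have e5 := e (false, false) (true, true) isT.
have e6 := e (true, true) (false, false) isT.
have e7 := e (true, false) (true, true) isT.
have e8 := e (true, true) (true, false) isT.
have e9 := e (false, true) (true, true) isT.
have e10 := e (true, true) (false, true) isT.
by rewrite /step /lo /hi; case: b c c' => -[] [] [[] []] [[] []] //= _; lra.
Qed.

Lemma step_div b c : step b g c / step b h c = mid (lo b c) (hi b c).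
Proof.
rewrite /step; case: eqP => // ->; rewrite /mid /lo /hi !eqxx /=.
by have := h_gt0 c => hc; field; rewrite !gt_eqF //; lra.
Qed.

Lemma osc_step b c c' : edge c c' ->
  `|step b g c / step b h c - step b g c' / step b h c'| <= 3 / 4 * D.
Proof.
move=> cc'; rewrite !step_div.
(* Neighbouring new vertices are midpoints of possibly degenerate edges with a common end, and all
   the ends are pairwise adjacent. *)
have common A B C E : [|| A == C, A == E, B == C | B == E] ->
    [&& edge A B, edge A C, edge A E, edge B C, edge B E & edge C E] ->
    `|mid A B - mid C E| <= 3 / 4 * D.
  move=> /or4P[] /eqP -> /and5P[h1 h2 h3 h4 /andP[h5 h6]].
  - by rewrite midC; apply: osc_mid => //; rewrite edgeC.
  - by rewrite midC (midC C); apply: osc_mid => //; rewrite edgeC.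
  - exact: osc_mid.
  - by rewrite (midC C); apply: osc_mid => //; rewrite edgeC.
by apply: common; move: cc'; case: b c c' => -[] [] [[] []] [[] []].
Qed.

(** The new value at [(false, false)] is a mediant along an edge leaving the old one, so it moves by
    at most one oscillation. This links successive levels at the entry that [word_weight] reads. *)
Lemma osc_step0 b : `|step b g (false, false) / step b h (false, false)
  - g (false, false) / h (false, false)| <= D.
Proof.
rewrite step_div.
have [A -> hA] : exists2 A, mid (lo b (false, false)) (hi b (false, false)) =
    mid (false, false) A & edge (false, false) A.
  by case: b => -[] []; [exists (true, true)|exists (true, false)|
    exists (false, true)|exists (false, false)] => //; rewrite midC.
have h1 := h_gt0 (false, false); have hA0 := h_gt0 A.
rewrite (_ : _ - _ = h A / (h (false, false) + h A) *
   (g A / h A - g (false, false) / h (false, false))); last first.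
  by rewrite /mid; field; rewrite !gt_eqF //; lra.
have xA : `|g A / h A - g (false, false) / h (false, false)| <= D.
  by apply: osc; rewrite edgeC.
rewrite normrM; apply: le_trans xA; rewrite ler_piMl // ger0_norm.
  by rewrite ler_pdivrMr; lra.
by rewrite divr_ge0; lra.
Qed.

End contraction.

(** All four entries of the row vector, since the recursion mixes them; [carry_count] explains why
    the index is a carry. *)
Definition carry z m n c : R :=
  (const_mx 1 *m \prod_(m <= i < n) Amat R (z i) : 'rV[R]_4) 0 (digit_idx c).

Lemma carry_nil z m c : carry z m m c = 1.
Proof. by rewrite /carry big_geq // mulmx1 mxE. Qed.

Lemma carryS z m n c : (m <= n)%N -> carry z m n.+1 c = step (z n) (carry z m n) c.
Proof. by move=> mn; rewrite /carry big_nat_recr //= mulmxA mulmx_Amat. Qed.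

Lemma word_weightE z m n : word_weight R z m n = carry z m n (false, false).
Proof.
rewrite /word_weight /carry -colE mxE; congr (_ _ _).
by apply: val_inj; rewrite /= inordK.
Qed.

Lemma carry_bounds z m n : (m <= n)%N ->
  (forall c, 0 < carry z m n c) /\
  (forall c c', edge c c' -> carry z m n c <= 3 * carry z m n c').
Proof.
move=> /subnK <-; elim: (n - m)%N => [|k [IH1 IH2]]; rewrite ?add0n.
  by split=> [c|c c' _]; rewrite !carry_nil ?ltr01 //; lra.
split=> [c|c c' cc']; rewrite addSn !carryS ?leq_addl //.
  exact: step_gt0.
exact: step_ratio.
Qed.

Lemma carry_gt0 z m n c : (m <= n)%N -> 0 < carry z m n c.
Proof. by move=> mn; case: (carry_bounds z mn). Qed.

Lemma step_bounds b g h : (forall c, 2 * h c <= g c <= 3 * h c) ->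
  forall c, 2 * step b h c <= step b g c <= 3 * step b h c.
Proof.
move=> H c; have := H b; have := H (lo b c); have := H (hi b c).
by rewrite /step; case: ifP => _; lra.
Qed.

(** Numerator and denominator pass through the same matrices after the first one, so they serve as
    [g] and [h] in the contraction. *)
Definition quot z n c : R := carry z 0 n.+1 c / carry z 1 n.+1 c.

(** One matrix turns the all-ones vector into entries 2 and 3, and linear inequalities between
    vectors pass through nonnegative matrices. *)
Lemma quot_bounds z n c : 2 <= quot z n c <= 3.
Proof.
have h1 := carry_gt0 z c (ltn0Sn n).
rewrite /quot ler_pdivlMr // ler_pdivrMr //; move: c {h1}.
elim: n => [|n IH] c; last first.
  by rewrite ![carry _ _ n.+2 _]carryS //; exact: step_bounds.
rewrite [carry z 0 1 c]carryS // carry_nil /step !carry_nil.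
by case: ifP => _; lra.
Qed.

Lemma quot_osc z n c c' : edge c c' ->
  `|quot z n c - quot z n c'| <= (3 / 4) ^+ n.
Proof.
elim: n c c' => [|n IH] c c' cc'.
  have := quot_bounds z 0 c; have := quot_bounds z 0 c'.
  by rewrite expr0 ler_norml; lra.
have [h1 h2] := carry_bounds z (ltn0Sn n).
rewrite /quot ![carry _ _ n.+2 _]carryS // exprS.
exact: osc_step.
Qed.

Lemma quot_cauchy z n :
  `|quot z n.+1 (false, false) - quot z n (false, false)| <= (3 / 4) ^+ n.
Proof.
have [h1 h2] := carry_bounds z (ltn0Sn n).
rewrite [X in X - _]/quot ![carry _ _ n.+2 _]carryS //.
by apply: osc_step0 => // c c'; exact: quot_osc.
Qed.

Lemma ln_lipschitz (x y : R) : 1 <= x -> 1 <= y -> `|ln x - ln y| <= `|x - y|.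
Proof.
have aux (u v : R) : 1 <= v -> v <= u -> ln u - ln v <= u - v.
  move=> v1 vu; have v0 : 0 < v by lra.
  have u0 : 0 < u by lra.
  rewrite -ln_div ?posrE // (_ : u / v = 1 + (u - v) / v); last first.
    by field; rewrite gt_eqF.
  apply: le_trans (le_ln1Dx _) _.
    by apply: lt_le_trans (_ : 0 <= _); [lra|rewrite divr_ge0; lra].
  by rewrite ler_pdivrMr // ler_peMr; lra.
move=> x1 y1; have [xy|yx] := leP x y.
  have lxy : ln x <= ln y by rewrite ler_ln ?posrE; lra.
  by rewrite !ler0_norm; [have := aux y x x1 xy; lra|lra|lra].
have lyx : ln y <= ln x by rewrite ler_ln ?posrE; lra.
by rewrite !ger0_norm; [have := aux x y y1 (ltW yx); lra|lra|lra].
Qed.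

(** Subtracting the geometric tail [w] makes [v] nondecreasing and adding it makes [v]
    nonincreasing; the two sequences enclose the limit, which gives the rate. *)
Lemma geometric_cauchy (v : nat -> R) (r : R) : 0 < r < 1 ->
  (forall n, `|v n.+1 - v n| <= r ^+ n) ->
  exists2 l, v @ \oo --> l & forall n, `|l - v n| <= r ^+ n / (1 - r).
Proof.
move=> /andP[r0 r1] vr.
pose w n := r ^+ n / (1 - r).
have w_recr n : w n - w n.+1 = r ^+ n by rewrite /w exprS; field; rewrite gt_eqF; lra.
have w0 n : 0 <= w n by rewrite divr_ge0 ?exprn_ge0; lra.
have w_cvg : w @ \oo --> (0 : R).
  rewrite -[0](mul0r (1 - r)^-1); apply: cvgMl; apply: cvg_expr.
  by rewrite ger0_norm; lra.
have vr1 n : - r ^+ n <= v n.+1 - v n <= r ^+ n by rewrite -ler_norml.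
pose a n := v n - w n; pose b n := v n + w n.
have a_nd : nondecreasing_seq a.
  apply/nondecreasing_seqP => n; rewrite /a; have := vr1 n; have := w_recr n; lra.
have b_ni : nonincreasing_seq b.
  apply/nonincreasing_seqP => n; rewrite /b; have := vr1 n; have := w_recr n; lra.
have a_cvg : cvgn a.
  apply: nondecreasing_is_cvgn => //; exists (b 0%N) => _ [n _ <-].
  by have := b_ni 0%N n (leq0n n); rewrite /a /b; have := w0 n; lra.
have v_cvg : v @ \oo --> limn a.
  rewrite -[limn a]addr0 (_ : v = fun n => a n + w n); last first.
    by apply/funext => n; rewrite /a subrK.
  exact: cvgD.
exists (limn a) => // n.
have b_cvg : b @ \oo --> limn a by rewrite -[limn a]addr0; apply: cvgD.
have h1 := nondecreasing_cvgn_le a_nd a_cvg n.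
have h2 : limn a <= b n.
  rewrite -(cvg_lim _ b_cvg) //; apply: nonincreasing_cvgn_ge => //.
  by apply/cvg_ex; exists (limn a).
by rewrite ler_norml; move: h1 h2; rewrite /a /b /w; lra.
Qed.

(** The quotients are at least 1, so their logarithms inherit the geometric estimate and the upper
    limit is a limit. The constant 4 is [1 / (1 - 3 / 4)]. *)
Lemma phi_approx z n :
  `|phi R z - ln (word_weight R z 0 n.+1 / word_weight R z 1 n.+1)| <=
  4 * (3 / 4) ^+ n.
Proof.
pose u := fun n => ln (word_weight R z 0 n / word_weight R z 1 n).
have uE k : u k.+1 = ln (quot z k (false, false)) by rewrite /u !word_weightE.
have [l ul lu] : exists2 l, (fun k => u k.+1) @ \oo --> l &
    forall n, `|l - u n.+1| <= (3 / 4) ^+ n / (1 - 3 / 4).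
  apply: geometric_cauchy; first by lra.
  move=> k; rewrite !uE; apply: le_trans (quot_cauchy z k).
  by apply: ln_lipschitz; have := quot_bounds z; [move=> /(_ k.+1)|move=> /(_ k)];
    move=> /(_ (false, false)); lra.
have -> : phi R z = l.
  have ul' : u @ \oo --> l by rewrite -cvg_shiftS.
  by case: (cvg_limn_inf_sup ul').
apply: le_trans (lu n) _.
by rewrite (_ : 1 - 3 / 4 = 4^-1 :> R) ?invrK 1?mulrC //; lra.
Qed.

Lemma iter_shift z j i : iter j Defs.shift z i = z (j + i)%N.
Proof. by elim: j i => [//|j IH] i; rewrite iterS /Defs.shift IH addnS. Qed.

Lemma word_weight_shift z j m n :
  word_weight R (iter j Defs.shift z) m n = word_weight R z (m + j) (n + j).
Proof.
rewrite /word_weight big_addn addnK; congr ((_ *m _ *m _) 0 0).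
by apply: eq_bigr => i _; rewrite iter_shift addnC.
Qed.

Lemma birkhoff_approx z n :
  `|birkhoff R n z - ln (word_weight R z 0 n)| <= 16.
Proof.
have ww m k : (m <= k)%N -> 0 < word_weight R z m k.
  by move=> mk; rewrite word_weightE; exact: carry_gt0.
(* Dropping one leading letter at a time, the term of index [j] is the finite-stage value of [phi]
   at the [j]-th shift. The errors [4 * (3 / 4) ^+ k] sum to at most 16. *)
have -> : ln (word_weight R z 0 n) = \sum_(0 <= j < n)
   (ln (word_weight R z j n) - ln (word_weight R z j.+1 n)).
  rewrite (telescope_sumr_eq (fun j => - ln (word_weight R z j n))) //.
    by rewrite [word_weight R z n n]word_weightE carry_nil ln1; ring.
  by move=> i _; ring.
rewrite /birkhoff -sumrB; apply: le_trans (ler_norm_sum _ _ _) _.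
apply: (@le_trans _ _ (\sum_(0 <= j < n) 4 * (3 / 4) ^+ (n - j.+1))).
  apply: ler_sum_nat => j /= jn.
  have := phi_approx (iter j Defs.shift z) (n - j.+1).
  rewrite !word_weight_shift add0n add1n subnSK // subnK 1?ltnW //.
  by rewrite ln_div ?posrE ?ww // ltnW.
rewrite big_nat_rev /= add0n -mulr_sumr.
have -> : \sum_(0 <= j < n) (3 / 4 : R) ^+ (n - (n - j.+1).+1) =
    4 * (1 - (3 / 4) ^+ n).
  rewrite (eq_big_nat _ _ (F2 := fun j => (3 / 4 : R) ^+ j)); last first.
    by move=> i /andP[_ iN]; rewrite subnSK // subKn // ltnW.
  elim: n {ww} => [|n IH]; first by rewrite big_geq // expr0 subrr mulr0.
  by rewrite big_nat_recr //= IH exprS; lra.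
have : 0 <= (3 / 4 : R) ^+ n by apply: exprn_ge0; lra.
by lra.
Qed.

End transfer.

(** * Matrix products as pair counts *)

Section words.
Variable R : realType.
Implicit Types (b c : digit) (z : nat -> digit) (n : nat).
Local Notation ind := (@pow2_dvd R).

Definition zdigit b : int * int := (b.1%:Z, b.2%:Z).

(** The digits of the Sierpinski gasket; an affine map sends them onto [digits], as used in
    [sum_vals_gasket]. *)
Definition gasket : seq (int * int) :=
  [seq zdigit d | d <- [:: (false, false); (true, false); (true, true)]].

Fixpoint prefix (f : nat -> bool) n : int :=
  if n is m.+1 then prefix f m *+ 2 + (f m)%:Z else 0.

Definition prefix1 z n := prefix (fun i => (z i).1) n.
Definition prefix2 z n := prefix (fun i => (z i).2) n.

Lemma eq_prefix f g n : (forall i, (i < n)%N -> f i = g i) -> prefix f n = prefix g n.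
Proof.
elim: n => //= n IH fg; rewrite IH => [|i iN]; last by rewrite fg // ltnW.
by rewrite fg.
Qed.

(** The low part lies between -3 and 1, so its even values are 0 and -2: the next carry is 0 or
    1. *)
Lemma ind_digits n x (d e b c : bool) :
  ind n.+1 (x *+ 2 + (d%:Z - e%:Z - b%:Z - c%:Z)) =
  if (d == e + b + c :> nat)%N then ind n x
  else if (d + 2 == e + b + c)%N then ind n (x - 1) else 0.
Proof. by rewrite ind_step; case: d e b c => -[] [] []; rewrite /= ?addr0. Qed.

Lemma sum_step (T : Type) (s : seq T) (t : T -> digit -> R) b c :
  step b (fun c => \sum_(P <- s) t P c) c = \sum_(P <- s) step b (t P) c.
Proof. by rewrite /step; case: ifP => _; rewrite ?mulr_sumr ?big_split. Qed.

(** The matrices are the transition matrices of bitwise subtraction of gasket words with carry [c];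
    the induction step is a finite check over the current digit and the carry. *)
Lemma carry_count z n c : carry R z 0 n c =
  \sum_(P <- vals gasket n) \sum_(Q <- vals gasket n)
    ind n (P.1 - Q.1 - prefix1 z n - c.1%:Z) *
    ind n (P.2 - Q.2 - prefix2 z n - c.2%:Z).
Proof.
elim: n c => [|n IH] c; first by rewrite carry_nil !big_vals0 !ind0 mulr1.
rewrite carryS // (funext IH).
rewrite sum_step big_valsS; apply: eq_bigr => P _.
rewrite sum_step; under [RHS]eq_bigr => d _ do rewrite big_valsS.
rewrite exchange_big; apply: eq_bigr => Q _ /=.
rewrite /gasket big_map; transitivity (
  \sum_(d <- [:: (false, false); (true, false); (true, true)])
   \sum_(e <- [:: (false, false); (true, false); (true, true)])
   (ind n.+1 ((P.1 - Q.1 - prefix1 z n) *+ 2 + (d.1%:Z - e.1%:Z - (z n).1%:Z - c.1%:Z)) *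
   ind n.+1 ((P.2 - Q.2 - prefix2 z n) *+ 2 + (d.2%:Z - e.2%:Z - (z n).2%:Z - c.2%:Z)))); last first.
  apply: eq_bigr => d _; rewrite big_map; apply: eq_bigr => e _.
  by congr (ind _ _ * ind _ _); rewrite /prefix1 /prefix2 /= !mulr1n; ring.
rewrite !big_cons !big_nil !ind_digits /step /lo /hi.
by case: (z n) => -[] []; case: c => -[] [] /=; rewrite ?subr0; ring.
Qed.

(** Padding with the zero digit leaves the coded point unchanged, which [ext_cylinder] relies on. *)
Definition ext n (w : {ffun 'I_n -> digit}) : nat -> digit :=
  fun i => oapp w (false, false) (insub i).

Definition snoc (T : finType) n (w : {ffun 'I_n -> T}) (b : T) : {ffun 'I_n.+1 -> T} :=
  [ffun i => oapp w b (unlift ord_max i)].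

Lemma sum_snoc (T : finType) n (F : {ffun 'I_n.+1 -> T} -> R) :
  \sum_w F w = \sum_(w : {ffun 'I_n -> T}) \sum_b F (snoc w b).
Proof.
rewrite pair_bigA /= (reindex (fun wb : {ffun 'I_n -> T} * T => snoc wb.1 wb.2)) //=.
exists (fun w : {ffun 'I_n.+1 -> T} => ([ffun j => w (lift ord_max j)], w ord_max)).
  move=> [w b] _ /=; rewrite /snoc ffunE unlift_none /=; congr (_, _).
  by apply/ffunP => j; rewrite !ffunE liftK.
move=> w _; apply/ffunP => i; rewrite !ffunE /=.
by case: unliftP => [j ->|->] //=; rewrite ffunE.
Qed.

Lemma ext_ord n (w : {ffun 'I_n -> digit}) (i : 'I_n) : ext w i = w i.
Proof. by rewrite /ext valK. Qed.

Lemma ext_snoc n (w : {ffun 'I_n -> digit}) b i : (i < n)%N ->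
  ext (snoc w b) i = ext w i.
Proof.
move=> iN; have := ext_ord (snoc w b) (lift ord_max (Ordinal iN)).
rewrite lift_max ffunE liftK /= => ->.
by have := ext_ord w (Ordinal iN).
Qed.

Lemma ext_snoc_last n (w : {ffun 'I_n -> digit}) b : ext (snoc w b) n = b.
Proof. by have := ext_ord (snoc w b) ord_max; rewrite ffunE unlift_none. Qed.

Lemma sum_digit (F : digit -> R) : \sum_b F b =
  F (true, true) + F (true, false) + (F (false, true) + F (false, false)).
Proof.
transitivity (\sum_(x : bool) \sum_(y : bool) F (x, y)); last by rewrite !big_bool.
by rewrite pair_bigA; apply: eq_bigr => -[x y].
Qed.

Lemma int_parity (x : int) : {y : int & {e : bool | x = y *+ 2 + e%:Z}}.
Proof.
exists (x %/ 2)%Z, ((x %% 2)%Z == 1).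
rewrite [LHS](divz_eq x 2) mulr_natr; congr (_ + _).
have := ltz_pmod x (isT : (0 : int) < 2); have := modz_ge0 x (isT : (2 : int) != 0).
by case: eqP => [->|] //; lia.
Qed.

(** Binary expansion is a bijection between words of length [n] and pairs of residues; the induction
    strips the lowest bits. *)
Lemma sum_prefix n x y : \sum_(w : {ffun 'I_n -> digit})
  ind n (x - prefix1 (ext w) n) * ind n (y - prefix2 (ext w) n) = 1.
Proof.
elim: n x y => [|n IH] x y.
  rewrite (eq_bigr (fun=> 1)) => [|w _]; last by rewrite !ind0 mulr1.
  by rewrite sumr_const card_ffun card_ord expn0.
have [x' [e ->]] := int_parity x; have [y' [e' ->]] := int_parity y.
rewrite sum_snoc -(IH x' y'); apply: eq_bigr => w _.
rewrite (eq_bigr (fun b : digit =>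
   ind n.+1 ((x' - prefix1 (ext w) n) *+ 2 + (e%:Z - b.1%:Z - false%:Z - false%:Z)) *
   ind n.+1 ((y' - prefix2 (ext w) n) *+ 2 + (e'%:Z - b.2%:Z - false%:Z - false%:Z)))).
  by rewrite sum_digit !ind_digits; case: e e' => -[] /=; ring.
move=> b _; rewrite /prefix1 /prefix2 /= !ext_snoc_last.
rewrite (@eq_prefix (fun i => (ext (snoc w b) i).1) (fun i => (ext w i).1)); last first.
  by move=> i iN; rewrite ext_snoc.
rewrite (@eq_prefix (fun i => (ext (snoc w b) i).2) (fun i => (ext w i).2)); last first.
  by move=> i iN; rewrite ext_snoc.
by congr (ind _ _ * ind _ _); ring.
Qed.

Variables p q : nat.

(* Listed so that the gasket digit (x, y) corresponds to [q y - p x + p]. *)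
Definition digits : seq int := [:: p%:Z; 0; q%:Z].

(** The affine map acts digit by digit, and its constant [p] accumulates over the [n] places to
    [p * (2 ^+ n - 1)]. *)
Lemma sum_vals_gasket n (F : int -> R) : \sum_(x <- vals digits n) F x =
  \sum_(P <- vals gasket n) F (q%:Z * P.2 - p%:Z * P.1 + p%:Z * (2 ^+ n - 1)).
Proof.
elim: n F => [|n IH] F.
  by rewrite !big_vals0 /= expr0; congr F; ring.
rewrite !big_valsS IH; apply: eq_bigr => P _.
rewrite !big_cons !big_nil !addr0 /= exprS; congr (F _ + (F _ + F _)); ring.
Qed.

(** A pair [(P, Q)] is counted by the unique [w] congruent to [P - Q], and this [w] passes the
    filter exactly when the two digit sums collide modulo [2 ^+ n]. The constant of
    [sum_vals_gasket] cancels in the difference. *)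
Lemma sum_word_weight n :
  \sum_(w : {ffun 'I_n -> digit} |
     (2 ^+ n %| q%:Z * prefix2 (ext w) n - p%:Z * prefix1 (ext w) n)%Z)
    word_weight R (ext w) 0 n = corr R digits n 0.
Proof.
rewrite /corr sum_vals_gasket big_mkcond /=.
rewrite (eq_bigr (fun w : {ffun 'I_n -> digit} =>
  \sum_(P <- vals gasket n) \sum_(Q <- vals gasket n)
  ind n (q%:Z * (P.2 - Q.2) - p%:Z * (P.1 - Q.1)) *
  (ind n (P.1 - Q.1 - prefix1 (ext w) n) * ind n (P.2 - Q.2 - prefix2 (ext w) n)))).
  rewrite exchange_big; apply: eq_bigr => P _ /=.
  rewrite exchange_big sum_vals_gasket; apply: eq_bigr => Q _ /=.
  by rewrite -mulr_sumr sum_prefix mulr1; congr ind; ring.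
move=> w _; rewrite word_weightE carry_count.
transitivity (\sum_(P <- vals gasket n) \sum_(Q <- vals gasket n)
  (ind n (q%:Z * prefix2 (ext w) n - p%:Z * prefix1 (ext w) n) *
  (ind n (P.1 - Q.1 - prefix1 (ext w) n) * ind n (P.2 - Q.2 - prefix2 (ext w) n)))).
  case: ifP => h /=; last first.
    by rewrite big1 // => P _; rewrite big1 // => Q _; rewrite {1}/pow2_dvd h mul0r.
  apply: eq_bigr => P _; apply: eq_bigr => Q _.
  by rewrite !subr0 -[LHS]mul1r; congr (_ * _); rewrite /pow2_dvd h.
apply: eq_bigr => P _; apply: eq_bigr => Q _; rewrite /pow2_dvd.
case: (boolP (_ %| P.1 - _ - _)%Z) => h1; last by rewrite mul0r !mulr0.
case: (boolP (_ %| P.2 - _ - _)%Z) => h2; last by rewrite !mulr0.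
congr (_%:R * _); congr nat_of_bool.
rewrite (_ : q%:Z * (P.2 - Q.2) - p%:Z * (P.1 - Q.1) =
  (q%:Z * (P.2 - Q.2 - prefix2 (ext w) n) - p%:Z * (P.1 - Q.1 - prefix1 (ext w) n))
  + (q%:Z * prefix2 (ext w) n - p%:Z * prefix1 (ext w) n)); last by ring.
by rewrite [RHS]rpredDl //; apply: rpredB; exact: dvdz_mull.
Qed.

Lemma prefixE (f : nat -> bool) n :
  \sum_(0 <= i < n) ((f i)%:R / 2 ^+ i.+1 : R) = (prefix f n)%:~R / 2 ^+ n.
Proof.
elim: n => [|n IH]; first by rewrite big_geq //= mul0r.
rewrite big_nat_recr //= IH intrD rmorphMn /= -pmulrn exprS.
by field; rewrite expf_eq0 pnatr_eq0 andbF.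
Qed.

Lemma pi_finE n (w : {ffun 'I_n -> digit}) : pi_fin R w =
  ((prefix1 (ext w) n)%:~R / 2 ^+ n, (prefix2 (ext w) n)%:~R / 2 ^+ n).
Proof.
by rewrite /pi_fin -!prefixE !big_mkord; congr (_, _); apply: eq_bigr => i _;
  rewrite ext_ord.
Qed.

(** * Words on the extended line and the pressure sums *)

Hypothesis pq : coprime p q.
Hypothesis q_gt0 : (0 < q)%N.

Lemma lpqP n (w : {ffun 'I_n -> digit}) : lpq p q (pi_fin R w) <->
  (2 ^+ n %| q%:Z * prefix2 (ext w) n - p%:Z * prefix1 (ext w) n)%Z.
Proof.
have q0 : (q%:R : R) != 0 by rewrite pnatr_eq0 -lt0n.
have e0 : (2 ^+ n : R) != 0 by rewrite expf_eq0 pnatr_eq0 andbF.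
rewrite pi_finE /lpq /congr1 /=.
set X := prefix1 _ _; set Y := prefix2 _ _; split.
  move=> [x' [y' [[k hk] [[l hl] e]]]]; apply/dvdzP.
  exists (q%:Z * l - p%:Z * k); apply/eqP; rewrite -(eqr_int R); apply/eqP.
  rewrite !rmorphB !rmorphM rmorphXn /= rmorphB !rmorphM /= -!pmulrn.
  have -> : Y%:~R = (y' + l%:~R) * 2 ^+ n :> R by rewrite -hl; field.
  have -> : X%:~R = (x' + k%:~R) * 2 ^+ n :> R by rewrite -hk; field.
  by rewrite -e; field.
move=> /dvdzP[m hm].
(* By Bezout every [m] is of the form [q l - p k], and translating by [(k, l)] brings the point onto
   the line itself. *)
have /coprimezP[[u v] /= huv] : coprimez p%:Z q%:Z by rewrite coprimezE.
pose k := - m * u; pose l := m * v.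
have ekl : q%:Z * l - p%:Z * k = m.
  by rewrite /k /l -[RHS]mulr1 -huv; ring.
exists (X%:~R / 2 ^+ n - k%:~R), (Y%:~R / 2 ^+ n - l%:~R).
split; first by exists k; ring.
split; first by exists l; ring.
have hmR : q%:R * Y%:~R - p%:R * X%:~R = (q%:R * l%:~R - p%:R * k%:~R) * 2 ^+ n :> R.
  have := congr1 (fun t : int => t%:~R : R) hm; rewrite -ekl.
  by rewrite !rmorphM !rmorphB !rmorphM rmorphXn /= -!pmulrn.
apply: (mulfI q0); apply: (mulIf e0).
have -> : q%:R * (Y%:~R / 2 ^+ n - l%:~R) * 2 ^+ n = q%:R * Y%:~R - q%:R * l%:~R * 2 ^+ n :> R.
  by field.
have -> : q%:R * Y%:~R = p%:R * X%:~R + (q%:R * l%:~R - p%:R * k%:~R) * 2 ^+ n :> R.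
  by rewrite -hmR; ring.
by field; rewrite q0 e0.
Qed.

Lemma eq_word_weight z z' n : (forall i, (i < n)%N -> z i = z' i) ->
  word_weight R z 0 n = word_weight R z' 0 n.
Proof.
move=> zz'; rewrite /word_weight; congr ((_ *m _ *m _) 0 0).
by apply: eq_big_nat => i /andP[_ iN]; rewrite zz'.
Qed.

(** Makes the cylinder of an admissible word nonempty, so that the [sup] in [pressure_seq] is a true
    supremum. *)
Lemma ext_cylinder n (w : {ffun 'I_n -> digit}) : lpq p q (pi_fin R w) ->
  cylinder R p q w (ext w).
Proof.
move=> hw; split; last by move=> i; rewrite ext_ord.
suff : pi_inf R (ext w) = pi_fin R w by rewrite /XN /= => ->.
have tail (f : digit -> bool) : f (false, false) = false ->
    limn (fun k => \sum_(0 <= i < k) ((f (ext w i))%:R / 2 ^+ i.+1 : R)) =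
    \sum_(i < n) ((f (w i))%:R / 2 ^+ i.+1).
  move=> f0; apply: lim_near_cst => //; near=> k.
  have nk : (n <= k)%N by near: k; exact: nbhs_infty_ge.
  rewrite (big_cat_nat (leq0n n) nk) /= [X in _ + X]big_nat [X in _ + X]big1.
    by rewrite addr0 big_mkord; apply: eq_bigr => i _; rewrite ext_ord.
  move=> i /andP[ni _]; rewrite /ext insubF /= ?f0 ?mul0r //.
  by rewrite ltnNge ni.
by rewrite /pi_inf /pi_fin (tail (fun d => d.1)) // (tail (fun d => d.2)).
Unshelve. all: by end_near.
Qed.

(** All points of a cylinder share the word weight up to [n], so by [birkhoff_approx] each summand
    is that weight up to a factor [expR 16]; the weights add up to [corr]. *)
Lemma pressure_seq_bound n : (0 < n)%N ->
  `|pressure_seq R p q n - n%:R^-1 * ln (corr R digits n 0)| <= n%:R^-1 * 16.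
Proof.
move=> n0; have n0' : 0 < n%:R^-1 :> R by rewrite invr_gt0 ltr0n.
rewrite /pressure_seq -mulrBr normrM gtr0_norm //; apply: ler_wpM2l; first exact: ltW.
set S := \sum_(w | _) _.
have c1 : 1 <= corr R digits n 0 by apply: corr_gt0; rewrite !inE eqxx orbT.
have ww z : 0 < word_weight R z 0 n by rewrite word_weightE; exact: carry_gt0.
suff /andP[S1 S2] : expR (- 16) * corr R digits n 0 <= S <= expR 16 * corr R digits n 0.
  have c0 : 0 < corr R digits n 0 by lra.
  have S0 : 0 < S by apply: lt_le_trans S1; rewrite mulr_gt0 ?expR_gt0.
  have l1 : ln (expR (- 16) * corr R digits n 0) <= ln S.
    by rewrite ler_ln ?posrE // mulr_gt0 ?expR_gt0.
  have l2 : ln S <= ln (expR 16 * corr R digits n 0).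
    by rewrite ler_ln ?posrE // mulr_gt0 ?expR_gt0.
  move: l1 l2; rewrite !lnM ?posrE ?expR_gt0 // !expRK => l1 l2.
  by rewrite ler_norml; lra.
rewrite -sum_word_weight.
have -> : S = \sum_(w : {ffun 'I_n -> digit} |
     (2 ^+ n %| q%:Z * prefix2 (ext w) n - p%:Z * prefix1 (ext w) n)%Z)
    expR (sup [set birkhoff R n om | om in cylinder R p q w]).
  by apply: eq_bigl => w; apply/asboolP/idP => /lpqP.
suff H (w : {ffun 'I_n -> digit}) :
    (2 ^+ n %| q%:Z * prefix2 (ext w) n - p%:Z * prefix1 (ext w) n)%Z ->
    expR (- 16) * word_weight R (ext w) 0 n <=
    expR (sup [set birkhoff R n om | om in cylinder R p q w]) <=
    expR 16 * word_weight R (ext w) 0 n.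
  by rewrite !mulr_sumr; apply/andP; split; apply: ler_sum => w /H /andP[].
move=> hw; rewrite -[word_weight _ _ _ _]lnK ?posrE // -!expRD !ler_expR.
set A := [set _ | _ in _]; set l := ln _.
have Abnd x : A x -> l - 16 <= x <= l + 16.
  move=> [om [_ om_w] <-]; have := birkhoff_approx R om n.
  rewrite (@eq_word_weight om (ext w)).
    by rewrite -/l ler_norml; lra.
  by move=> i iN; rewrite (om_w (Ordinal iN)) -ext_ord.
have A0 : A (birkhoff R n (ext w)).
  by exists (ext w) => //; apply: ext_cylinder; apply/lpqP.
have Aub : ubound A (l + 16) by move=> x /Abnd /andP[].
apply/andP; split.
  apply: le_trans (ub_le_sup _ A0); last by exists (l + 16).
  by have /andP[h _] := Abnd _ A0; rewrite addrC.
by rewrite addrC; apply: ge_sup => //; exists (birkhoff R n (ext w)).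
Qed.

End words.

(** * Existence of the pressure *)

Section pressure_limit.
Variable R : realType.

(** Fekete's subadditive lemma with limit [inf E]: divide [n] by a nearly optimal [m]. The sum [B]
    dominates every possible remainder term. *)
Lemma fekete (a : nat -> R) : (forall n, 0 <= a n) ->
  (forall m n, a (m + n)%N <= a m + a n) -> cvgn (fun n => n%:R^-1 * a n).
Proof.
move=> a0 asub.
pose E := [set n%:R^-1 * a n | n in [set n | (0 < n)%N]].
have Elb : lbound E 0.
  by move=> _ [n /= n0 <-]; rewrite mulr_ge0 ?invr_ge0.
have Einf : has_inf E by split; [exists (1%:R^-1 * a 1%N), 1%N|exists 0].
have amul m k r : a (k * m + r)%N <= k%:R * a m + a r.
  elim: k => [|k IH]; first by rewrite mul0n mul0r add0n add0r.
  rewrite mulSn -addnA; apply: le_trans (asub _ _) _.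
  by rewrite -[k.+1%:R]natr1 mulrDl mul1r; move: IH; lra.
apply/cvg_ex; exists (inf E); apply/cvgrPdist_le => e e0.
have e20 : 0 < e / 2 by lra.
have [_ [m /= m0 <-] hm] := inf_adherent e20 Einf.
pose B := \sum_(r < m) a r.
near=> n.
have Bn : 2 * B / e <= n%:R by near: n; exact: nbhs_infty_ger.
have n0 : (0 < n)%N by near: n; exact: nbhs_infty_gt.
have nR : 0 < n%:R :> R by rewrite ltr0n.
have mR : 0 < m%:R :> R by rewrite ltr0n.
have lo : inf E <= n%:R^-1 * a n by apply: ge_inf; [exists 0|exists n].
suff hi : n%:R^-1 * a n <= inf E + e by rewrite ler_norml; lra.
rewrite mulrC ler_pdivrMr //.
have Br : a (n %% m)%N <= B.
  have hr : (n %% m < m)%N by rewrite ltn_mod.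
  rewrite /B (bigD1 (Ordinal hr)) //= lerDl.
  by apply: sumr_ge0 => i _; exact: a0.
have hB : B <= e / 2 * n%:R by move: Bn; rewrite ler_pdivrMr //; lra.
have hk : (n %/ m)%:R * m%:R <= n%:R :> R.
  by rewrite -natrM ler_nat leq_trunc_div.
have am : a m <= m%:R * (inf E + e / 2).
  by move: hm; rewrite mulrC ltr_pdivrMr // => /ltW; rewrite mulrC.
have Einf0 : 0 <= inf E by apply: lb_le_inf => //; exists (1%:R^-1 * a 1%N), 1%N.
have := amul m (n %/ m)%N (n %% m)%N; rewrite -divn_eq.
have h1 : (n %/ m)%:R * a m <= (n %/ m)%:R * (m%:R * (inf E + e / 2)).
  by rewrite ler_wpM2l.
have h2 : (n %/ m)%:R * m%:R * (inf E + e / 2) <= n%:R * (inf E + e / 2).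
  by rewrite ler_wpM2r //; lra.
move: h1 h2 hB Br; rewrite mulrA; lra.
Unshelve. all: by end_near.
Qed.

Variables p q : nat.
Hypothesis pq : coprime p q.
Hypothesis q_gt0 : (0 < q)%N.
Local Notation corr := (corr R (digits p q)).

Lemma pressure_cvg : (fun n => n%:R^-1 * ln (corr n 0)) @ \oo --> pressure R p q.
Proof.
have c1 n : 1 <= corr n 0 by apply: corr_gt0; rewrite !inE eqxx orbT.
have c0 n : 0 < corr n 0 by apply: lt_le_trans (c1 n).
have h : cvgn (fun n => n%:R^-1 * ln (corr n 0)).
  apply: fekete => [n|m n]; first by rewrite ln_ge0.
  by rewrite -lnM ?posrE // ler_ln ?posrE ?mulr_gt0 // corrD.
rewrite /pressure (_ : limn _ = limn (fun n => n%:R^-1 * ln (corr n 0))) //.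
apply/cvg_lim => //.
rewrite -[limn _]add0r.
rewrite (_ : pressure_seq R p q = fun n =>
  (pressure_seq R p q n - n%:R^-1 * ln (corr n 0)) + n%:R^-1 * ln (corr n 0)); last first.
  by apply/funext => n; rewrite subrK.
apply: cvgD => //.
apply/cvgrPdist_le => e e0; near=> n; rewrite sub0r normrN.
have n0 : (0 < n)%N by near: n; exact: nbhs_infty_gt.
apply: le_trans (pressure_seq_bound _ pq q_gt0 n0) _.
rewrite mulrC ler_pdivrMr ?ltr0n // mulrC -ler_pdivrMr //.
by near: n; exact: nbhs_infty_ger.
Unshelve. all: by end_near.
Qed.

Lemma corr_le_expR (t : R) : pressure R p q < t ->
  exists N, forall n, (N <= n)%N -> corr n 0 <= expR (n%:R * t).
Proof.
move=> Pt.
have c1 n : 1 <= corr n 0 by apply: corr_gt0; rewrite !inE eqxx orbT.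
have : \forall n \near \oo, n%:R^-1 * ln (corr n 0) < t.
  by apply: (cvgr_lt _ pressure_cvg).
move=> [N _ HN]; exists N.+1 => n Nn.
have n0 : 0 < n%:R :> R by rewrite ltr0n (leq_ltn_trans _ Nn).
have := HN n (ltnW Nn); rewrite /= mulrC ltr_pdivrMr // => h.
rewrite -[corr n 0]lnK ?posrE ?(lt_le_trans _ (c1 n)) // ler_expR.
by rewrite mulrC ltW.
Qed.

End pressure_limit.

(** * Fourier coefficients of the digit sums *)

Section entropy_drop.
Variable R : realType.
Variables p q : nat.
Local Notation ds := (digits p q).
Local Notation gamma := (residue_count R ds).
Local Notation ind := (@pow2_dvd R).

(** Real and imaginary parts of the exponential sum over words; [char_norm] is its squared
    modulus. *)
Definition cos_sum n (t : R) : R := \sum_(x <- vals ds n) cos (t * x%:~R).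
Definition sin_sum n (t : R) : R := \sum_(x <- vals ds n) sin (t * x%:~R).
Definition char_norm n t := cos_sum n t ^+ 2 + sin_sum n t ^+ 2.
Definition digit_norm t : R := (\sum_(d <- ds) cos (t * d%:~R)) ^+ 2 +
  (\sum_(d <- ds) sin (t * d%:~R)) ^+ 2.

Lemma char_normS n t : char_norm n.+1 t = char_norm n (2 * t) * digit_norm t.
Proof.
have arg (x d : int) : t * (x *+ 2 + d)%:~R = 2 * t * x%:~R + t * d%:~R.
  by rewrite intrD rmorphMn /=; ring.
rewrite /char_norm /digit_norm.
set C := \sum_(d <- ds) cos _; set S := \sum_(d <- ds) sin _.
have -> : cos_sum n.+1 t = cos_sum n (2 * t) * C - sin_sum n (2 * t) * S.
  rewrite /cos_sum /sin_sum big_valsS !mulr_suml -sumrB; apply: eq_bigr => x _.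
  by rewrite !mulr_sumr -sumrB; apply: eq_bigr => d _; rewrite arg cosD.
have -> : sin_sum n.+1 t = sin_sum n (2 * t) * C + cos_sum n (2 * t) * S.
  rewrite /cos_sum /sin_sum big_valsS !mulr_suml -big_split; apply: eq_bigr => x _.
  by rewrite /= !mulr_sumr -big_split; apply: eq_bigr => d _; rewrite arg sinD.
ring.
Qed.

(* Two unit vectors and 1 sum to zero only if they are the primitive cube roots
   of unity, and cos = -1/2 is a fixed point of angle doubling. *)
Lemma digit_norm_gt0 t m : cos (2 ^+ m * (t * p%:R)) = 1 -> 0 < digit_norm t.
Proof.
move=> hm; rewrite /digit_norm !big_cons !big_nil !addr0 mulr0 cos0 sin0 add0r.
rewrite -!pmulrn; set a := t * p%:R in hm *; set b := t * q%:R.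
rewrite lt_neqAle addr_ge0 ?sqr_ge0 // andbT eq_sym paddr_eq0 ?sqr_ge0 //.
rewrite !expf_eq0 /=; apply/negP => /andP[/eqP h1 /eqP h2].
have ha := cos2Dsin2 a; have hb := cos2Dsin2 b.
have hs : sin a ^+ 2 = sin b ^+ 2 by rewrite -[sin b]opprK -sqrrN opprK; congr (_ ^+ 2); lra.
have hab : cos a = cos b.
  have : (cos a - cos b) * (cos a + cos b) = 0 by rewrite -subr_sqr; lra.
  move/eqP; rewrite mulf_eq0 => /orP[/eqP ?|/eqP ?]; lra.
have ca : cos a = - (1 / 2) by lra.
suff : forall k, cos (2 ^+ k * a) = - (1 / 2) by move=> /(_ m); lra.
elim=> [|k IH]; first by rewrite expr0 mul1r.
rewrite exprS (_ : 2 * _ * a = (2 ^+ k * a) *+ 2); last by ring.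
by rewrite cos_mulr2n IH; lra.
Qed.

(** The hypothesis passes from [t] to [2 * t] by the double-angle formula, so no factor of the
    product from [char_normS] vanishes. *)
Lemma char_norm_gt0 n t m : cos (2 ^+ m * (t * p%:R)) = 1 -> 0 < char_norm n t.
Proof.
elim: n t => [|n IH] t hm.
  by rewrite /char_norm /cos_sum /sin_sum !big_vals0 mulr0 cos0 sin0; lra.
rewrite char_normS mulr_gt0 ?(digit_norm_gt0 hm) // IH //.
rewrite (_ : _ * _ = (2 ^+ m * (t * p%:R)) *+ 2); last by ring.
by rewrite cos_mulr2n hm; lra.
Qed.

Section functional.
Variable k : nat.
Let L := k.+1.
Let t : R := pi / 2 ^+ k.

(** The real part of [exp(i t x)] times the conjugate of the exponential sum at [t]: the test
    function whose sum over the words is the squared modulus. *)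
Definition weight (x : int) : R :=
  cos_sum L t * cos (t * x%:~R) + sin_sum L t * sin (t * x%:~R).

Lemma weight_half x : weight (x + 2 ^+ k) = - weight x.
Proof.
rewrite /weight (_ : t * (x + 2 ^+ k)%:~R = t * x%:~R + pi).
  by rewrite cosDpi sinDpi; ring.
by rewrite intrD rmorphXn /= /t; field; rewrite expf_eq0 pnatr_eq0 andbF.
Qed.

Lemma weight_period x y : (2 ^+ L %| x - y)%Z -> weight x = weight y.
Proof.
move=> /dvdzP[m hm].
have per u : weight (u + 2 ^+ L) = weight u.
  by rewrite /L exprS (_ : u + _ = u + 2 ^+ k + 2 ^+ k) ?weight_half ?opprK //; ring.
have pern (n : nat) u : weight (u + n%:Z * 2 ^+ L) = weight u.
  elim: n u => [|n IH] u; first by rewrite mul0r addr0.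
  by rewrite (_ : u + _ = u + n%:Z * 2 ^+ L + 2 ^+ L) ?per ?IH // -natz -natr1 natz; ring.
have -> : x = y + m * 2 ^+ L by rewrite -hm; ring.
case: m {hm} => n; first exact: pern.
rewrite NegzE -[LHS](pern n.+1); congr weight; ring.
Qed.

Lemma sum_weight : \sum_(i < 2 ^ L) weight i%:Z = 0.
Proof.
rewrite /L expnS mul2n -addnn big_split_ord /= -big_split big1 // => i _.
by rewrite /= addnC PoszD Posz_exp2 weight_half subrr.
Qed.

Lemma sum_weight_gamma c : \sum_(i < 2 ^ L) weight i%:Z * gamma L (i%:Z - c) =
  char_norm L t * cos (t * c%:~R).
Proof.
transitivity (\sum_(x <- vals ds L) weight (x + c)).
  under eq_bigr => i _ do rewrite mulr_sumr.
  rewrite exchange_big; apply: eq_bigr => x _ /=.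
  rewrite -[RHS]mulr1 -(sum_ind R L (x + c)) mulr_sumr; apply: eq_bigr => i _.
  rewrite (_ : x - (i%:Z - c) = x + c - i%:Z); last by ring.
  rewrite /pow2_dvd; case: (boolP (_ %| _)%Z) => h; last by rewrite !mulr0.
  by rewrite (weight_period h).
have aux x : weight (x + c) =
   (cos_sum L t * cos (t * c%:~R) + sin_sum L t * sin (t * c%:~R)) * cos (t * x%:~R) +
   (sin_sum L t * cos (t * c%:~R) - cos_sum L t * sin (t * c%:~R)) * sin (t * x%:~R).
  by rewrite /weight intrD mulrDr cosD sinD; ring.
under eq_bigr => x _ do rewrite aux.
rewrite big_split -!mulr_sumr -/(cos_sum L t) -/(sin_sum L t) /= /char_norm.
ring.
Qed.

(** The angles [t * c] stay in [[0, pi]], where the cosine decreases, so the worst carry is [q]. *)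
Lemma sum_weight_gamma_ge (c : nat) : (c <= q)%N -> (q.*2.+2 <= 2 ^ k)%N ->
  char_norm L t * cos (t * q%:R) <= \sum_(i < 2 ^ L) weight i%:Z * gamma L (i%:Z - c%:Z).
Proof.
move=> cq qk; rewrite sum_weight_gamma ler_wpM2l ?addr_ge0 ?sqr_ge0 // -pmulrn.
have pi0 := pi_gt0 R.
have e0 : 0 < 2 ^+ k :> R by rewrite exprn_gt0.
have t0 : 0 <= t by rewrite divr_ge0 // ltW.
have tq : t * q%:R <= pi.
  rewrite /t mulrAC ler_pdivrMr //; apply: ler_wpM2l; first exact: ltW.
  rewrite -natrX ler_nat.
  by apply: leq_trans qk; rewrite -addnn; lia.
have tc : t * c%:R <= t * q%:R by rewrite ler_wpM2l // ler_nat.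
by rewrite leNgt ltr_cos -?leNgt // in_itv /= mulr_ge0 //= (le_trans tc).
Qed.

(** Here [2 ^+ L * t = 2 pi], so [char_norm_gt0] applies with [m = L], and [2 q < 2 ^ k] keeps
    [t * q] below [pi / 2]. *)
Lemma weight_gamma_gt0 : (q.*2.+2 <= 2 ^ k)%N -> 0 < char_norm L t * cos (t * q%:R).
Proof.
move=> qk; have pi0 := pi_gt0 R.
have e0 : 0 < 2 ^+ k :> R by rewrite exprn_gt0.
rewrite mulr_gt0 //.
  apply: (@char_norm_gt0 _ _ L).
  rewrite (_ : _ * _ = (p%:R * pi) *+ 2).
    by rewrite mulr_natl -mulrnA mulnC mulrnA; elim: (p) => [|n IH];
      rewrite ?mulr0n ?cos0 // mulrSr cosD2pi.
  by rewrite /L /t exprS; field; rewrite gt_eqF.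
apply: cos_gt0_pihalf; apply/andP; split.
  apply: (@lt_le_trans _ _ 0); first by lra.
  by rewrite mulr_ge0 // divr_ge0 // ltW.
rewrite /t mulrAC ltr_pdivrMr // -mulrA ltr_pM2l //.
have : (q.*2.+2%:R <= 2 ^+ k :> R) by rewrite -natrX ler_nat.
rewrite -addnn -2!natr1 natrD; lra.
Qed.

End functional.
End entropy_drop.

(** * Decay of the L^(1/2) norm *)

Section root_sum.
Variable R : realType.

(** Cauchy-Schwarz with a gain: equality would need [x] constant, but constants are orthogonal to
    [beta], so correlation with [beta] measures the loss. *)
Lemma sqrt_sum_gap (I : finType) (x beta : I -> R) (eta B : R) :
  0 < eta -> eta <= B -> (forall i, 0 <= x i) -> (forall i, `|beta i| <= B) ->
  \sum_i beta i = 0 -> eta * \sum_i x i <= \sum_i beta i * x i ->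
  \sum_i Num.sqrt (x i) <=
  (1 - eta ^+ 2 / (8 * B ^+ 2)) * Num.sqrt (#|I|%:R * \sum_i x i).
Proof.
move=> eta0 etaB x0 bB b0 hx; set X := \sum_i x i in hx *.
have B0 : 0 < B by lra.
have X0 : 0 <= X by apply: sumr_ge0.
have [X0'|Xneq] := eqVneq X 0.
  rewrite X0' mulr0 sqrtr0 mulr0 big1 // => i _.
  have /(_ i) : forall i, x i = 0.
    by move=> j; move/eqP: X0'; rewrite psumr_eq0 // => /allP /(_ j); rewrite mem_index_enum => /(_ isT)/eqP.
  by move=> ->; rewrite sqrtr0.
have Xgt0 : 0 < X by rewrite lt_neqAle eq_sym Xneq.
have N0 : 0 < #|I|%:R :> R.
  rewrite ltr0n lt0n; apply: contra Xneq => /eqP/card0_eq cI.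
  by rewrite /X big1 // => i; have := cI i; rewrite inE.
pose m := Num.sqrt (X / #|I|%:R); pose s i := Num.sqrt (x i).
have m0 : 0 < m by rewrite sqrtr_gt0 divr_gt0.
have m2 : #|I|%:R * m ^+ 2 = X.
  by rewrite sqr_sqrtr ?divr_ge0 ?ltW // mulrC divfK // gt_eqF.
have s2 i : s i ^+ 2 = x i by rewrite sqr_sqrtr.
have hN : Num.sqrt (#|I|%:R * X) = #|I|%:R * m.
  rewrite -m2 mulrA -expr2 -exprMn sqrtr_sqr ger0_norm // mulr_ge0 ?ltW //.
have sum_cst (c : R) : \sum_(i : I) c = #|I|%:R * c.
  by rewrite sumr_const mulr_natl.
(* AM-GM with [x i - m ^+ 2 = (s i - m) * (s i + m)], where [s] is the root of [x]
   and [m] its value for the uniform distribution. *)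
have key : \sum_i beta i * x i <= \sum_i (eta / 8 * (s i + m) ^+ 2 + 2 * B ^+ 2 / eta * (s i - m) ^+ 2).
  have -> : \sum_i beta i * x i = \sum_i beta i * ((s i - m) * (s i + m)).
    apply/eqP; rewrite -subr_eq0 -sumrB (eq_bigr (fun i => beta i * m ^+ 2)).
      by rewrite -mulr_suml b0 mul0r.
    by move=> i _; rewrite -s2; ring.
  apply: ler_sum => i _.
  have h1 : beta i * ((s i - m) * (s i + m)) <= B * (`|s i - m| * (s i + m)).
    apply: le_trans (ler_norm _) _; rewrite !normrM.
    rewrite [`|s i + m|]ger0_norm ?addr_ge0 ?sqrtr_ge0 //.
    by apply: ler_wpM2r => //; rewrite mulr_ge0 ?addr_ge0 ?sqrtr_ge0.
  apply: le_trans h1 _; rewrite -(real_normK (num_real (s i - m))).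
  set u := `|s i - m|; set v := s i + m.
  have := sqr_ge0 (eta / 4 * v - B * u) => h.
  rewrite -subr_ge0 (_ : _ - _ = 2 / eta * (eta / 4 * v - B * u) ^+ 2).
    by rewrite mulr_ge0 // divr_ge0 // ltW.
  by field; rewrite gt_eqF.
(* With the weight [eta / 8] this term costs half of [eta * X]; the other half must come from the
   spread of [s] around [m]. *)
have S1 : \sum_i (s i + m) ^+ 2 <= 4 * X.
  apply: (@le_trans _ _ (\sum_i (2 * x i + 2 * m ^+ 2))).
    by apply: ler_sum => i _; rewrite -s2; have := sqr_ge0 (s i - m); rewrite sqrrB sqrrD; lra.
  by rewrite big_split /= -mulr_sumr sum_cst -/X; lra.
have S2 : \sum_i (s i - m) ^+ 2 = 2 * X - 2 * m * \sum_i s i.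
  rewrite (eq_bigr (fun i => x i + m ^+ 2 - 2 * m * s i)); last first.
    by move=> i _; rewrite -s2; ring.
  by rewrite sumrB big_split /= sum_cst m2 -mulr_sumr -/X; ring.
rewrite hN -/X; set S := \sum_i _; rewrite -/S in S2.
have key2 : eta * X <= eta / 8 * (4 * X) + 2 * B ^+ 2 / eta * (2 * X - 2 * m * S).
  apply: le_trans hx _; apply: le_trans key _.
  rewrite big_split /= -!mulr_sumr S2 lerD2r ler_wpM2l //; lra.
have key3 : m * S <= (1 - eta ^+ 2 / (8 * B ^+ 2)) * X.
  (* Scaling by this factor gives [m * S] the coefficient one. *)
  have c0 : 0 < eta / (4 * B ^+ 2) by rewrite divr_gt0 // mulr_gt0 // exprn_gt0.
  move: key2; rewrite -(ler_pM2l c0) => key2.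
  rewrite -subr_ge0; move: key2; rewrite -subr_ge0 => key2.
  rewrite (_ : _ - _ = eta / (4 * B ^+ 2) * (eta / 8 * (4 * X) + 2 * B ^+ 2 / eta * (2 * X - 2 * m * S)) -
         eta / (4 * B ^+ 2) * (eta * X)) //.
  by field; rewrite !gt_eqF.
rewrite -(ler_pM2l m0); apply: le_trans key3 _.
by rewrite -m2 le_eqVlt; apply/orP; left; apply/eqP; ring.
Qed.

Lemma big_ord_mul a b (g : nat -> R) : \sum_(J < a * b) g J =
  \sum_(i < a) \sum_(j < b) g (j + i * b)%N.
Proof.
elim: a => [|a IH]; first by rewrite !big_ord0.
rewrite mulSnr big_split_ord /= IH big_ord_recr /=; congr (_ + _).
by apply: eq_bigr => j _; rewrite addnC.
Qed.

Variables p q : nat.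
Hypothesis pq : (p <= q)%N.
Local Notation ds := (digits p q).
Local Notation gamma := (residue_count R ds).

Lemma vals_bounds n x : x \in vals ds n -> 0 <= x <= q%:Z * (2 ^+ n - 1).
Proof.
elim: n x => [|n IH] x; first by rewrite inE => /eqP ->; rewrite expr0 subrr mulr0.
rewrite /vals iterS -/(vals ds n) => /allpairsP[[y d] /= [/IH hy hd ->]].
have : 0 <= d <= q%:Z by move: hd; rewrite !inE => /or3P[] /eqP ->; lia.
by rewrite exprS; lia.
Qed.

(** Cauchy-Schwarz bounds it by the square root of [6 ^+ n], the value for equal counts; this is
    where the 6 in [root_sumD] comes from. *)
Definition root_sum n : R := \sum_(j < 2 ^ n) Num.sqrt (gamma n j%:Z).

Lemma root_sum0 : root_sum 0 = 1.
Proof.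
by rewrite /root_sum expn0 big_ord1 /residue_count big_vals0 ind0 sqrtr1.
Qed.

(** Above each low residue [j], the [2 ^ L] counts are a mixture over carries of translates of
    [gamma L]. [sqrt_sum_gap] applies to each such family, with a gain independent of [n] and
    [j]. *)
Lemma root_sumD : exists L, exists2 lam : R, 0 < lam < 1 &
  (0 < L)%N /\
  forall n, root_sum (L + n) <= lam * Num.sqrt (6 ^+ L) * root_sum n.
Proof.
pose k := q.*2.+2.
have qk : (q.*2.+2 <= 2 ^ k)%N by apply: ltnW; exact: ltn_expl.
pose L := k.+1; exists L.
set t : R := pi / 2 ^+ k.
pose eta' := char_norm p q L t * cos (t * q%:R).
have eta'0 : 0 < eta' by exact: weight_gamma_gt0.
(* The family above [j] has total [3 ^+ L * gamma n j], while [eta'] is a bound per unit of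
   [gamma n j]. *)
pose eta := eta' / 3 ^+ L.
have eta0 : 0 < eta by rewrite divr_gt0 // exprn_gt0.
pose B := `|cos_sum p q L t| + `|sin_sum p q L t| + eta.
have etaB : eta <= B by rewrite lerDr addr_ge0.
have B0 : 0 < B by lra.
have wB x : `|weight R p q k x| <= B.
  apply: (@le_trans _ _ (`|cos_sum p q L t| + `|sin_sum p q L t|)); last by rewrite lerDl ltW.
  apply: le_trans (ler_normD _ _) _; rewrite !normrM.
  by apply: lerD; rewrite ler_piMr // ?cos_max ?sin_max.
have B2 : 0 < 8 * B ^+ 2 by rewrite mulr_gt0 // exprn_gt0.
have h1 : 0 < eta ^+ 2 / (8 * B ^+ 2) by apply: divr_gt0 => //; exact: exprn_gt0.
have h2 : eta ^+ 2 / (8 * B ^+ 2) <= 1 / 8.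
  rewrite ler_pdivrMr // (_ : 1 / 8 * _ = B ^+ 2); last by field.
  by rewrite ler_pXn2r ?nnegrE // ltW.
exists (1 - eta ^+ 2 / (8 * B ^+ 2)); first by lra.
split=> // n.
have e2 : (0 < 2 ^+ n :> int) by rewrite exprn_gt0.
rewrite {1}/root_sum expnD.
rewrite (big_ord_mul _ _ (fun J => Num.sqrt (gamma (L + n) J%:Z))) exchange_big /= /root_sum mulr_sumr.
apply: ler_sum => j _.
have catE (i : 'I_(2 ^ L)) : gamma (L + n) (j + i * 2 ^ n)%N%:Z =
    \sum_(x <- vals ds n) pow2_dvd R n (x - j%:Z) * gamma L (i%:Z - ((x - j%:Z) %/ (2 ^+ n))%Z).
  by rewrite -gamma_cat PoszD PoszM -mulr_natr natz.
have sumX : \sum_(i < 2 ^ L) gamma (L + n) (j + i * 2 ^ n)%N%:Z = 3 ^+ L * gamma n j%:Z.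
  rewrite (eq_bigr _ (fun i _ => catE i)) exchange_big mulr_sumr.
  by apply: eq_bigr => x _; rewrite -mulr_sumr sum_gamma /= natrX mulrC.
have := @sqrt_sum_gap 'I_(2 ^ L) (fun i => gamma (L + n) (j + i * 2 ^ n)%N%:Z)
  (fun i => weight R p q k i%:Z) eta B eta0 etaB (fun i => gamma_ge0 _ _ _ _)
  (fun i => wB _) (sum_weight _ _ _ _).
rewrite sumX card_ord => H; apply: le_trans (H _) _.
  rewrite mulrA /eta divfK ?gt_eqF ?exprn_gt0 //.
  rewrite (eq_bigr (fun i : 'I_(2 ^ L) => \sum_(x <- vals ds n) pow2_dvd R n (x - j%:Z) *
    (weight R p q k i%:Z * gamma L (i%:Z - ((x - j%:Z) %/ (2 ^+ n))%Z)))); last first.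
    by move=> i _; rewrite catE mulr_sumr; apply: eq_bigr => x _; rewrite mulrCA.
  rewrite exchange_big mulr_sumr big_seq [X in _ <= X]big_seq.
  apply: ler_sum => x /vals_bounds /andP[x0 xq]; rewrite -mulr_sumr mulrC.
  rewrite /pow2_dvd; case: (boolP (_ %| _)%Z) => h; last by rewrite !mul0r.
  rewrite !mul1r; have hj := ltn_ord j.
  have hj' : j%:Z < 2 ^+ n by rewrite -Posz_exp2; lia.
  have hd := divzK h; set c := ((x - j%:Z) %/ (2 ^+ n))%Z in hd *.
  (* From [0 <= x <= q (2 ^+ n - 1)] and [0 <= j < 2 ^+ n], the carry [c] lies between 0 and [q]. *)
  have c0 : 0 <= c by nia.
  have cq : c <= q%:Z by nia.
  by have := @sum_weight_gamma_ge R p q k `|c|%N; rewrite gez0_abs //; apply => //; lia.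
rewrite -mulrA; apply: ler_wpM2l; first by lra.
by rewrite mulrA natrX -exprMn sqrtrM ?exprn_ge0 // -natrM.
Qed.

Lemma root_sum_decay : exists2 L, (0 < L)%N & exists2 lam : R, 0 < lam < 1 &
  forall k, root_sum (k * L) <= (lam * Num.sqrt (6 ^+ L)) ^+ k.
Proof.
have [L [lam lam01 [L0 H]]] := root_sumD; exists L => //; exists lam => //.
elim=> [|k IH]; first by rewrite mul0n root_sum0 expr0.
rewrite mulSn exprS; apply: le_trans (H _) _.
by rewrite ler_wpM2l // mulr_ge0 ?sqrtr_ge0 //; lra.
Qed.

End root_sum.

(** * The self-similar measure on dyadic cells *)

Section measure.
Variable R : realType.
Variable mu : probability R R.

Definition prob (A : set R) : R := fine (mu A).

Local Notation pr := prob.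

Lemma prE A : measurable A -> mu A = (pr A)%:E.
Proof. by move=> mA; rewrite /prob fineK // fin_num_measure. Qed.

Lemma pr_ge0 A : 0 <= pr A. Proof. exact: fine_ge0. Qed.

Lemma pr_le A B : measurable A -> measurable B -> A `<=` B -> pr A <= pr B.
Proof. by move=> mA mB AB; rewrite -lee_fin -!prE // le_measure ?inE. Qed.

Lemma pr_setT : pr setT = 1. Proof. by rewrite /prob probability_setT. Qed.

Lemma pr_set0 : pr set0 = 0. Proof. by rewrite /prob measure0. Qed.

Lemma pr_le1 A : measurable A -> pr A <= 1.
Proof. by move=> mA; rewrite -pr_setT pr_le. Qed.

Lemma pr_setC A : measurable A -> pr (~` A) = 1 - pr A.
Proof.
by move=> mA; apply: EFin_inj; rewrite -prE ?EFinB -?prE ?probability_setC //; exact: measurableC.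
Qed.

Lemma pr_setU A B : measurable A -> measurable B -> pr (A `|` B) <= pr A + pr B.
Proof.
move=> mA mB; rewrite -lee_fin EFinD -!prE //; last exact: measurableU.
exact: measureU2.
Qed.

Lemma measurable_floor (c : R) (P : set int) :
  0 <= c -> measurable [set t : R | P (Num.floor (c * t))].
Proof.
move=> c0; pose f (t : R) : R := (Num.floor (c * t))%:~R.
have mf : measurable_fun setT f.
  apply: nondecreasing_measurable => // x y xy.
  by rewrite ler_int; apply: le_floor; rewrite ler_wpM2l.
have -> : [set t | P (Num.floor (c * t))] = setT `&` f @^-1` [set k%:~R | k in P].
  apply/seteqP; split=> t /=.
    by move=> Pt; split=> //; exists (Num.floor (c * t)).
  by move=> [_ [k Pk]]; rewrite /f => /intr_inj <-.
apply: mf => //; apply: countable_measurable => [x|]; first exact: measurable_set1.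
apply: (sub_countable (B := P)); [exact: card_image_le | exact: countableP].
Qed.

(** Grid intervals of length [1 / c] are merged when their indices agree modulo [2 ^+ n]; the masses
    of this finite family are exact convolutions, by [pr_cell]. *)
Definition cell (c : R) n (j : int) : set R :=
  [set t | (2 ^+ n %| Num.floor (c * t) - j)%Z].

Lemma measurable_cell c n j : 0 <= c -> measurable (cell c n j).
Proof. exact: (@measurable_floor c [set k | (2 ^+ n %| k - j)%Z]). Qed.

Lemma eq_cell c n j k : (2 ^+ n %| j - k)%Z -> cell c n j = cell c n k.
Proof.
move=> h; apply/seteqP; split=> t; rewrite /cell /= => ht.
  have -> : Num.floor (c * t) - k = (Num.floor (c * t) - j) + (j - k) by ring.
  exact: rpredD.
have -> : Num.floor (c * t) - j = (Num.floor (c * t) - k) - (j - k) by ring.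
exact: rpredB.
Qed.

Lemma pr_split c n E : 0 <= c -> measurable E ->
  pr E = \sum_(j < 2 ^ n) pr (E `&` cell c n j%:Z).
Proof.
move=> c0 mE; have mEc k : measurable (E `&` cell c n k).
  by apply: measurableI => //; exact: measurable_cell.
have e2 : (2 ^+ n : int) != 0 by rewrite expf_eq0 andbF.
have modj (x : int) : exists2 j, (j < 2 ^ n)%N & (2 ^+ n %| x - j%:Z)%Z.
  exists `|(x %% 2 ^+ n)%Z|%N.
    rewrite -ltz_nat Posz_exp2 gez0_abs ?modz_ge0 //.
    by apply: ltz_pmod; rewrite exprn_gt0.
  by rewrite gez0_abs ?modz_ge0 // -eqz_mod_dvd modz_mod.
have uniq (x : int) i j : (i < 2 ^ n)%N -> (j < 2 ^ n)%N ->
    (2 ^+ n %| x - i%:Z)%Z -> (2 ^+ n %| x - j%:Z)%Z -> i = j.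
  move=> iN jN; rewrite -!eqz_mod_dvd => /eqP h1 /eqP h2.
  have : (i%:Z %% 2 ^+ n)%Z = (j%:Z %% 2 ^+ n)%Z by rewrite -h1 -h2.
  by rewrite !modz_small -?Posz_exp2 ?ltz_nat // => -[].
apply: EFin_inj; rewrite -prE // -sumEFin.
have EE : E = \big[setU/set0]_(j < 2 ^ n) (E `&` cell c n j%:Z).
  apply/seteqP; split=> t.
    move=> Et; have [j jN hj] := modj (Num.floor (c * t)).
    by rewrite -(bigcup_mkord _ (fun j => E `&` cell c n j%:Z)); exists j.
  by rewrite -(bigcup_mkord _ (fun j => E `&` cell c n j%:Z)) => -[j _ []].
have tv : trivIset `I_(2 ^ n) (fun j : nat => E `&` cell c n j%:Z).
  by move=> i j /= iN jN [t [[_ ti] [_ tj]]]; exact: (uniq (Num.floor (c * t))).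
rewrite [in LHS]EE (measure_semi_additive_ord_I mu (fun k _ => mEc k%:Z) tv).
  by apply: eq_bigr => j _; exact: prE.
by apply: bigsetU_measurable => k _.
Qed.

Lemma measurable_affine A (a b : R) : measurable A ->
  measurable [set t : R | A ((t + a) / b)].
Proof.
move=> mA; rewrite -[X in measurable X]setTI.
have mf : measurable_fun setT (fun t : R => (t + a) / b).
  apply: measurable_funM => //; apply: measurable_funD => //.
exact: mf.
Qed.

Section self_similar.
Variables p q : nat.
Hypothesis pq : (p <= q)%N.
Hypothesis q_gt0 : (0 < q)%N.
Hypothesis hmu : self_similar_pq p q mu.
Local Notation ds := (digits p q).
Local Notation gamma := (residue_count R ds).
Local Notation corr := (corr R ds).
Local Notation ind := (@pow2_dvd R).

Let qR : 0 < q%:R :> R. Proof. by rewrite ltr0n. Qed.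

Lemma pr_half A : measurable A ->
  pr A = 1 / 3 * \sum_(d <- ds) pr [set t | A ((t + d%:~R / q%:R) / 2)].
Proof.
move=> mA; apply: EFin_inj; rewrite -prE // hmu // [RHS]EFinM.
have imgE (d : R) : [set 2 * a - d | a in A] = [set t | A ((t + d) / 2)].
  apply/seteqP; split=> t /=.
    by move=> [a Aa <-]; rewrite subrK mulrC mulKf.
  by move=> At; exists ((t + d) / 2) => //; field.
have -> : [set 2 * a | a in A] = [set 2 * a - 0 | a in A].
  by apply: eq_imagel => a _; rewrite subr0.
rewrite !imgE !prE; try exact: measurable_affine.
rewrite -!EFinD; congr (_ * _)%E; congr EFin.
rewrite !big_cons big_nil addr0 mul0r -!pmulrn divff ?gt_eqF //.
by rewrite [RHS]addrC.
Qed.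

Lemma pr_selfsim A n : measurable A -> pr A = 3 ^- n *
  \sum_(x <- vals ds n) pr [set t | A ((t + x%:~R / q%:R) / 2 ^+ n)].
Proof.
move=> mA; elim: n => [|n IH].
  rewrite expr0 invr1 mul1r big_vals0; congr pr.
  by apply/seteqP; split=> t /=; rewrite mul0r addr0 mulr1.
rewrite IH big_valsS exprS invfM [3^-1 * _]mulrC -mulrA; congr (_ * _).
rewrite mulr_sumr; apply: eq_bigr => x _.
rewrite pr_half; last exact: measurable_affine.
rewrite mul1r; congr (_ * _); apply: eq_bigr => d _; congr pr.
apply: eq_set => t; congr A.
rewrite intrD rmorphMn /= exprS; field.
by rewrite ?expf_eq0 ?pnatr_eq0 ?andbF gt_eqF.
Qed.

(** The factor [q * 2 ^+ n] turns the translation by [x / q] into the integer [x], which leaves the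
    floor. *)
Lemma pr_selfsim_floor n (P : set int) :
  pr [set t | P (Num.floor (q%:R * 2 ^+ n * t))] = 3 ^- n *
  \sum_(x <- vals ds n) pr [set t | P (Num.floor (q%:R * t) + x)].
Proof.
rewrite (pr_selfsim n); last first.
  by apply: measurable_floor; rewrite mulr_ge0 ?exprn_ge0 // ltW.
congr (_ * _); apply: eq_bigr => x _; congr pr; apply: eq_set => t /=.
congr P; rewrite (_ : _ * _ = q%:R * t + x%:~R).
  by rewrite floorDrz ?intrKfloor // intr_int.
by field; rewrite ?expf_eq0 ?pnatr_eq0 ?andbF gt_eqF.
Qed.

Lemma pr_cell n j : pr (cell (q%:R * 2 ^+ n) n j) =
  \sum_(i < 2 ^ n) pr (cell q%:R n i%:Z) * (3 ^- n * gamma n (j - i%:Z)).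
Proof.
have q0 : 0 <= q%:R :> R by rewrite ltW.
rewrite (@pr_selfsim_floor n [set k | (2 ^+ n %| k - j)%Z]).
under [RHS]eq_bigr => i _ do rewrite mulrCA.
rewrite -mulr_sumr; congr (_ * _).
under [RHS]eq_bigr => i _ do rewrite /residue_count mulr_sumr.
rewrite exchange_big; apply: eq_bigr => x _ /=.
have -> : [set t | (2 ^+ n %| Num.floor (q%:R * t) + x - j)%Z] = cell q%:R n (j - x).
  by apply: eq_set => t; congr (is_true (_ %| _)%Z); ring.
rewrite -[LHS]mulr1 -(sum_ind R n (j - x)) mulr_sumr; apply: eq_bigr => i _.
rewrite -[in RHS]indN (_ : - (x - _) = j - x - i%:Z); last by ring.
rewrite /pow2_dvd; case: (boolP (_ %| _)%Z) => h; last by rewrite !mulr0.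
by rewrite (eq_cell _ h).
Qed.

(** Jensen for the averaging weights of [pr_cell]; by [sum_gamma2] each translate has the same sum
    of squares. *)
Lemma sum_pr_cell2 n :
  \sum_(j < 2 ^ n) pr (cell (q%:R * 2 ^+ n) n j%:Z) ^+ 2 <= 9 ^- n * corr n 0.
Proof.
have q0 : 0 <= q%:R :> R by rewrite ltW.
have m1 : \sum_(i < 2 ^ n) pr (cell q%:R n i%:Z) = 1.
  transitivity (pr setT); last exact: pr_setT.
  by rewrite (pr_split n q0 measurableT); apply: eq_bigr => i _; rewrite setTI.
have jensen (g : 'I_(2 ^ n) -> R) :
    (\sum_(i < 2 ^ n) pr (cell q%:R n i%:Z) * g i) ^+ 2 <=
    \sum_(i < 2 ^ n) pr (cell q%:R n i%:Z) * g i ^+ 2.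
  set a := \sum_(i < _) _ * g i.
  have : 0 <= \sum_(i < 2 ^ n) pr (cell q%:R n i%:Z) * (g i - a) ^+ 2.
    by apply: sumr_ge0 => i _; rewrite mulr_ge0 ?pr_ge0 ?sqr_ge0.
  rewrite (eq_bigr (fun i : 'I_(2 ^ n) => pr (cell q%:R n i%:Z) * g i ^+ 2 -
     2 * a * (pr (cell q%:R n i%:Z) * g i) + a ^+ 2 * pr (cell q%:R n i%:Z))).
    rewrite big_split sumrB /= -!mulr_sumr m1 -/a; lra.
  by move=> i _; ring.
apply: (@le_trans _ _ (\sum_(j < 2 ^ n) \sum_(i < 2 ^ n)
   pr (cell q%:R n i%:Z) * (3 ^- n * gamma n (j%:Z - i%:Z)) ^+ 2)).
  by apply: ler_sum => j _; rewrite pr_cell; exact: jensen.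
rewrite exchange_big /=.
rewrite (eq_bigr (fun i : 'I_(2 ^ n) => pr (cell q%:R n i%:Z) * (9 ^- n * corr n 0))).
  by rewrite -mulr_suml m1 mul1r.
move=> i _; rewrite -mulr_sumr; congr (_ * _).
under eq_bigr => j _ do rewrite exprMn.
rewrite -mulr_sumr sum_gamma2; congr (_ * _).
by rewrite -exprVn -exprM mulnC exprM -exprVn; congr (_ ^+ n); field.
Qed.

(** The slack around [[0, 1]] makes points escape: one outside [[-1, 2]] has all its preimages under
    [k] steps of self-similarity outside [[-k, 1 + k]], a set whose mass tends to zero. *)
Lemma pr_support : pr [set t : R | t < - 1 \/ 2 < t] = 0.
Proof.
pose O (r : R) := [set t : R | t < - r \/ 1 + r < t].
have mO r : measurable (O r).
  have -> : O r = `]-oo, - r[%classic `|` `]1 + r, +oo[%classic.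
    by apply/seteqP; split=> t; rewrite /O /= !in_itv /= andbT.
  by apply: measurableU.
have -> : [set t : R | t < - 1 \/ 2 < t] = O 1 by rewrite /O -[1 + 1]/(2%:R).
apply/eqP; rewrite eq_le pr_ge0 andbT.
pose F k := [set t : R | - k%:R <= t <= 1 + k%:R].
have mF k : measurable (F k).
  have -> : F k = `[- k%:R, 1 + k%:R]%classic.
    by apply/seteqP; split=> t; rewrite /F /= in_itv.
  exact: measurable_itv.
have FO k : F k = ~` O k%:R.
  apply/seteqP; split=> t; rewrite /F /O /=.
    by move=> /andP[h1 h2] []; lra.
  by move=> h; apply/andP; split; rewrite leNgt; apply/negP => h2; apply: h; [left|right].
have F1 : (mu \o F) @ \oo --> mu (\bigcup_k F k).
  apply: nondecreasing_cvg_mu => //; first exact: bigcup_measurable.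
  move=> m n mn; apply/subsetPset => t; rewrite /F /= => /andP[h1 h2].
  have mnR : (m%:R <= n%:R :> R) by rewrite ler_nat.
  by lra.
have FT : \bigcup_k F k = setT.
  apply/seteqP; split=> t // _; exists (Num.bound `|t|) => //.
  have : `|t| < (Num.bound `|t|)%:R by apply: archi_boundP.
  by rewrite ltr_norml /F /=; lra.
rewrite FT probability_setT in F1.
apply/ler_addgt0Pr => e e0; rewrite add0r.
have : \forall k \near \oo, 1 - e < pr (F k).
  by move/fine_cvgP: F1 => [_ F1]; apply: (cvgr_gt _ F1); lra.
move=> [k _ /(_ k (leqnn k))]; rewrite /= FO pr_setC // => hk.
apply: (@le_trans _ _ (pr (O k%:R))); last by lra.
rewrite (pr_selfsim k) //.
have k2 : (k%:R <= 2 ^+ k :> R) by rewrite -natrX ler_nat ltnW // ltn_expl.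
have e2 : 0 < 2 ^+ k :> R by rewrite exprn_gt0.
rewrite mulrC ler_pdivrMr ?exprn_gt0 //.
apply: (@le_trans _ _ (\sum_(x <- vals ds k) pr (O k%:R))); last first.
  by rewrite big_tnth sumr_const card_ord size_vals -[X in X <= _]mulr_natr natrX.
rewrite big_seq [X in _ <= X]big_seq; apply: ler_sum => x /(vals_bounds pq) /andP[x0 xq].
apply: pr_le => //; first exact: measurable_affine.
have x0' : 0 <= x%:~R / q%:R :> R by rewrite divr_ge0 ?ler0z // ltW.
have xq' : x%:~R / q%:R <= 2 ^+ k - 1 :> R.
  rewrite ler_pdivrMr // mulrC; have : (x%:~R <= (q%:Z * (2 ^+ k - 1))%:~R :> R) by rewrite ler_int.
  by rewrite intrM intrB rmorphXn /= -!pmulrn.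
move=> t; rewrite /O /= ltr_pdivrMr // ltr_pdivlMr //; case; [left|right]; lra.
Qed.

End self_similar.
End measure.

(** * Lower bound for the dimension *)

Section hausdorff.
Variable R : realType.

Lemma geometric_eseries_le (f : nat -> \bar R) (c th : R) : 0 <= c -> 0 < th < 1 ->
  (forall k, (0 <= f k)%E) -> (forall k, (f k <= (c * th ^+ k)%:E)%E) ->
  (\sum_(0 <= k <oo) f k <= (c / (1 - th))%:E)%E.
Proof.
move=> c0 /andP[th0 th1] f0 fc.
apply: lime_le; first by apply: is_cvg_nneseries => n _ _.
apply: nearW => n; apply: (@le_trans _ _ (\sum_(0 <= k < n) (c * th ^+ k)%:E)%E).
  by apply: lee_sum => k _.
rewrite sumEFin lee_fin.
have -> : \sum_(0 <= k < n) c * th ^+ k = c * (1 - th ^+ n) / (1 - th).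
  elim: n => [|n IH]; first by rewrite big_geq // expr0 subrr mulr0 mul0r.
  by rewrite big_nat_recr //= IH exprS; field; rewrite gt_eqF //; lra.
rewrite ler_wpM2r ?invr_ge0; [by []|lra|].
have := exprn_ge0 n (ltW th0) => h.
by rewrite ler_piMr //; lra.
Qed.

Lemma diam_dist (U : set R) x y : U x -> U y -> (`|x - y|%:E <= diam U)%E.
Proof.
move=> Ux Uy; rewrite /diam; case: asboolP => [U0|_]; first by rewrite U0 in Ux.
by apply: ereal_sup_ubound; exists (x, y).
Qed.

Lemma diam_ge0 (U : set R) : (0 <= diam U)%E.
Proof.
have [->|/set0P[x Ux]] := eqVneq U set0; first by rewrite /diam asboolT.
by apply: le_trans (diam_dist Ux Ux); rewrite subrr normr0.
Qed.

Lemma hcontent_ge0 s (U : set R) : (0 <= hcontent s U)%E.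
Proof. by rewrite /hcontent; case: asboolP => // _; exact: poweR_ge0. Qed.

Lemma hausdorff_measure0_cover s d e (A : set R) : 0 < d -> 0 < e ->
  hausdorff_measure s A = 0%E ->
  exists U : nat -> set R, [/\ A `<=` \bigcup_i U i,
    forall i, (diam (U i) <= d%:E)%E &
    (\sum_(0 <= i <oo) hcontent s (U i) <= e%:E)%E].
Proof.
move=> d0 e0 H0.
have : (hausdorff_delta s d A < e%:E)%E.
  apply: (@le_lt_trans _ _ 0%E); last by rewrite lte_fin.
  by rewrite -H0; apply: ereal_sup_ubound; exists d.
by move=> /ereal_inf_lt[_ [U [AU Ud] <-] /ltW he]; exists U.
Qed.

Variable mu : probability R R.
Local Notation pr := (prob mu).

(** The measurable [C] stands in for the arbitrary [U], and the extra [e] handles sets of diameter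
    zero, whose content may vanish. *)
Lemma mass_distribution (A : set R) (s K e0 : R) (G : set R) :
  measurable G -> G `<=` A -> 0 < pr G -> 0 < e0 ->
  (forall U : set R, (diam U <= e0%:E)%E -> forall e : R, 0 < e ->
     exists C, [/\ measurable C, U `&` G `<=` C &
                   (mu C <= K%:E * hcontent s U + e%:E)%E]) ->
  0 <= K -> hausdorff_measure s A <> 0%E.
Proof.
move=> mG GA G0 e00 local K0 H0.
(* Chosen so that the total [K * e + e] is half of [pr G]. *)
pose e := pr G / (2 * (K + 1)).
have e1 : 0 < e by rewrite divr_gt0 // mulr_gt0 //; lra.
have [U [AU Ud Ue]] := hausdorff_measure0_cover e00 e1 H0.
have /choice[C HC] : forall i, exists C, [/\ measurable C, U i `&` G `<=` C &
    (mu C <= K%:E * hcontent s (U i) + (e / (2 ^ i.+1)%:R)%:E)%E].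
  by move=> i; apply: local => //; rewrite divr_gt0 // ltr0n expn_gt0.
have mC i : measurable (C i) by case: (HC i).
have GC : G `<=` \bigcup_i C i.
  move=> x Gx; have [i _ Ux] := AU x (GA x Gx); exists i => //.
  by case: (HC i) => _ + _; apply.
have h1 := measure_sigma_subadditive mu mC mG GC.
have h2 : (\sum_(0 <= i <oo) mu (C i) <=
    \sum_(0 <= i <oo) (K%:E * hcontent s (U i) + (e / (2 ^ i.+1)%:R)%:E))%E.
  by apply: lee_nneseries => [i _ _|i _]; [exact: measure_ge0|case: (HC i)].
have Kh i : (0 <= K%:E * hcontent s (U i))%E.
  by rewrite mule_ge0 ?lee_fin ?hcontent_ge0.
have h3 := @epsilon_trick R (fun i => K%:E * hcontent s (U i))%E e xpredT Kh (ltW e1).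
rewrite nneseriesZl in h3; last by move=> i _; exact: hcontent_ge0.
have h4 : (K%:E * \sum_(0 <= i <oo) hcontent s (U i) <= K%:E * e%:E)%E.
  by rewrite lee_wpmul2l // lee_fin.
have : (mu G <= K%:E * e%:E + e%:E)%E.
  apply: le_trans h1 _; apply: le_trans h2 _; apply: le_trans h3 _.
  by rewrite leeD2r.
rewrite (@prE R mu) // -EFinM -EFinD lee_fin.
have -> : K * e + e = pr G / 2 by rewrite /e; field; rewrite gt_eqF //; lra.
by lra.
Qed.

End hausdorff.

(** * Heavy cells and the lower bound *)

Section lower.
Variable R : realType.
Variable mu : probability R R.
Local Notation pr := (prob mu).
Variables p q : nat.
Hypothesis pq : (p <= q)%N.
Hypothesis cpq : coprime p q.
Hypothesis q_gt0 : (0 < q)%N.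
Hypothesis hmu : self_similar_pq p q mu.
Local Notation corr := (corr R (digits p q)).

Let qR : 0 < q%:R :> R. Proof. by rewrite ltr0n. Qed.

Local Notation freq n := (q%:R * 2 ^+ n : R).
Local Notation gridcell n k := (cell (freq n) n k).

Let freq_gt0 n : 0 < freq n.
Proof. by rewrite mulr_gt0 // exprn_gt0. Qed.

Definition heavy n (tau : R) : set R :=
  [set t | tau < pr (gridcell n (Num.floor (freq n * t)))].

Lemma measurable_heavy n tau : measurable (heavy n tau).
Proof.
exact: (@measurable_floor _ _ (fun k => tau < pr (gridcell n k)) (ltW (freq_gt0 n))).
Qed.

(** Chebyshev: on a heavy cell [tau] is below the mass, so [tau] times the mass is below its
    square. *)
Lemma pr_heavy n tau : 0 < tau -> tau * pr (heavy n tau) <= 9 ^- n * corr n 0.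
Proof.
move=> tau0; apply: le_trans (sum_pr_cell2 q_gt0 hmu n).
have mc j : measurable (gridcell n j) by apply: measurable_cell; rewrite ltW.
rewrite (pr_split mu n (ltW (freq_gt0 n)) (measurable_heavy n tau)) mulr_sumr.
apply: ler_sum => j _.
have [hj|hj] := ltP tau (pr (gridcell n j%:Z)).
  rewrite expr2; apply: ler_pM; rewrite ?pr_ge0 //; first exact: ltW.
    exact: ltW.
  apply: pr_le; [|exact: mc|exact: subIsetr].
  by apply: measurableI; [exact: measurable_heavy|exact: mc].
rewrite (_ : heavy n tau `&` _ = set0) ?pr_set0 ?mulr0 ?sqr_ge0 //.
apply/seteqP; split=> // t [ht hc]; move: ht; rewrite /heavy /= (@eq_cell R (freq n) n _ j%:Z) //.
by rewrite ltNge hj.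
Qed.

(** A set no wider than one grid step meets at most three consecutive cells, and each light one has
    mass at most [tau]. *)
Lemma light_cover n tau (U : set R) : 0 <= tau ->
  (diam U <= ((freq n)^-1)%:E)%E ->
  exists C, [/\ measurable C, U `\` heavy n tau `<=` C & pr C <= 3 * tau].
Proof.
move=> tau0 hU.
have mc j : measurable (gridcell n j) by apply: measurable_cell; rewrite ltW.
have [->|/set0P[x0 Ux0]] := eqVneq U set0.
  by exists set0; split; [exact: measurable0|move=> x []|rewrite pr_set0 mulr_ge0].
pose light k : set R := if pr (gridcell n k) <= tau then gridcell n k else set0.
have ml k : measurable (light k) by rewrite /light; case: ifP.
have prl k : pr (light k) <= tau.
  by rewrite /light; case: ifP => // _; rewrite pr_set0.
pose m := Num.floor (freq n * x0).
exists (light (m - 1) `|` light m `|` light (m + 1)); split.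
- by apply: measurableU => //; exact: measurableU.
- move=> y [Uy /negP]; rewrite /heavy /= -leNgt => hy.
  have lighty : light (Num.floor (freq n * y)) y.
    by rewrite /light hy /cell /= subrr dvdz0.
  have : `|y - x0| <= (freq n)^-1.
    by rewrite -lee_fin; apply: le_trans hU; exact: diam_dist.
  rewrite -(ler_pM2l (freq_gt0 n)) divff ?gt_eqF // -{1}(gtr0_norm (freq_gt0 n)) -normrM.
  rewrite mulrBr ler_norml => /andP[h1 h2].
  have := floor_itv (freq n * y); have := floor_itv (freq n * x0).
  rewrite -/m !intrD => /andP[m1 m2] /andP[k1 k2].
  set k := Num.floor (freq n * y) in lighty k1 k2 *.
  have km : (k%:~R < (m + 2)%:~R :> R) by rewrite intrD; lra.
  have mk : ((m - 2)%:~R < k%:~R :> R) by rewrite intrD rmorphN /=; lra.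
  move: km mk; rewrite !ltr_int => km mk.
  have : [\/ k = m - 1, k = m | k = m + 1].
    by have [?|?|?] := ltgtP k m; [constructor 1|constructor 3|constructor 2]; lia.
  by case=> <-; [left; left|left; right|right].
- apply: le_trans (pr_setU _ _ _) _ => //; first exact: measurableU.
  have := pr_setU mu (ml (m - 1)) (ml m).
  have := prl (m - 1); have := prl m; have := prl (m + 1); lra.
Qed.

Lemma dyadic_scale (n1 : nat) (d : R) : 0 < d <= (freq n1)^-1 ->
  exists n, [/\ (n1 <= n)%N, d <= (freq n)^-1 & (freq n.+1)^-1 < d].
Proof.
move=> /andP[d0 dn1].
have ex : exists n, (freq (n1 + n))^-1 < d.
  exists (Num.bound d^-1).
  rewrite invf_plt ?posrE //; apply: lt_le_trans (archi_boundP _) _.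
    by rewrite invr_ge0 ltW.
  set b := Num.bound _.
  have : (b <= q * 2 ^ (n1 + b))%N.
    apply: leq_trans (ltnW (ltn_expl b (isT : (1 < 2)%N))) _.
    apply: leq_trans (leq_pmull _ q_gt0); rewrite leq_exp2l //; exact: leq_addl.
  by rewrite -(ler_nat R) natrM natrX.
case: (ex_minnP ex) => [[|n] hn min_n].
  by move: hn; rewrite addn0 ltNge dn1.
exists (n1 + n)%N; split; first exact: leq_addr.
  by rewrite leNgt; apply/negP => /min_n; rewrite ltnn.
by rewrite -addnS.
Qed.

Lemma measure_dim_ge :
  (((ln 9 - pressure R p q) / ln 2)%:E <= measure_dim mu)%E.
Proof.
have l2 : 0 < ln 2 :> R by rewrite ln_gt0 // ltr1n.
have l9 : expR (ln 9) = 9 :> R by rewrite lnK // posrE.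
apply: le_ereal_inf_tmp => _ [A [mA muA] <-].
apply: le_ereal_inf_tmp => _ [s [s0 Hs] <-].
rewrite lee_fin leNgt; apply/negP => s_lt.
set s2 := (_ / ln 2) in s_lt.
(* Thirds of the gap between [s] and [s2]: [t] fixes the threshold [2^(-n t)], [t'] bounds the
   collision growth, and their difference makes the heavy mass geometric with ratio [th]. *)
pose t := (2 * s + s2) / 3; pose t' := (s + 2 * s2) / 3.
have st : s < t by rewrite /t; lra.
have tt' : t < t' by rewrite /t /t'; lra.
have t's : t' < s2 by rewrite /t'; lra.
have Pt : pressure R p q < ln 9 - t' * ln 2.
  by move: t's; rewrite /s2 ltr_pdivlMr //; lra.
have [N HN] := corr_le_expR cpq q_gt0 Pt.
pose tau n := expR (- (n%:R * (t * ln 2))) : R.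
have tau0 n : 0 < tau n by exact: expR_gt0.
pose th := expR (- ((t' - t) * ln 2)) : R.
have th01 : 0 < th < 1.
  by rewrite expR_gt0 expR_lt1 oppr_lt0 mulr_gt0 // subr_gt0.
have bad n : (N <= n)%N -> pr (heavy n (tau n)) <= th ^+ n.
  move=> Nn; rewrite -(ler_pM2l (tau0 n)); apply: le_trans (pr_heavy n (tau0 n)) _.
  apply: (@le_trans _ _ (9 ^- n * expR (n%:R * (ln 9 - t' * ln 2)))).
    by rewrite ler_wpM2l ?HN // invr_ge0 exprn_ge0.
  rewrite -{1}l9 -expRM_natl -expRN /tau /th -expRM_natl -!expRD ler_expR.
  by rewrite le_eqVlt; apply/orP; left; apply/eqP; ring.
have [n0 hn0] : exists n0, th ^+ n0 / (1 - th) <= 1 / 2.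
  have cvg0 : (fun n => th ^+ n) @ \oo --> (0 : R).
    by apply: cvg_expr; rewrite ger0_norm; case/andP: th01 => // /ltW.
  have : \forall n \near \oo, th ^+ n < (1 - th) / 2.
    by apply: (cvgr_lt _ cvg0); case/andP: th01 => ? ?; lra.
  move=> [n _ /(_ n (leqnn n)) /= hn]; exists n.
  by rewrite ler_pdivrMr; case/andP: th01 => ? ?; lra.
(* From level [n1] on the heavy sets have total mass at most 1/2, so a part [G] of [A] of positive
   mass is light at all these scales. *)
pose n1 := (N + n0)%N.
pose Bad := \bigcup_k heavy (n1 + k)%N (tau (n1 + k)%N).
have mBad : measurable Bad by apply: bigcup_measurable => k _; exact: measurable_heavy.
have prBad : pr Bad <= 1 / 2.
  rewrite -lee_fin -prE //.
  apply: le_trans (measure_sigma_subadditive mu (fun k => measurable_heavy _ _) mBad (@subset_refl _ _)) _.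
  apply: le_trans (_ : ((th ^+ n1 / (1 - th))%:E <= _)%E).
    apply: geometric_eseries_le => //.
    - by rewrite exprn_ge0 //; case/andP: th01 => /ltW.
    - move=> k; rewrite [X in (X <= _)%E](prE mu (measurable_heavy _ _)).
      by rewrite lee_fin -exprD bad // /n1 -addnA leq_addr.
  rewrite lee_fin; apply: le_trans hn0.
  rewrite ler_wpM2r ?invr_ge0; [by []| case/andP: th01 => ? ?; lra |].
  case/andP: th01 => ? ?; rewrite /n1 exprD ler_piMl ?exprn_ge0 ?exprn_ile1 //; lra.
pose G := A `\` Bad.
have mG : measurable G by exact: measurableD.
have prG : 0 < pr G.
  have : pr A <= pr G + pr Bad.
    apply: le_trans (pr_setU mu mG mBad); apply: pr_le => //; first exact: measurableU.
    by move=> x Ax; have [?|?] := pselect (Bad x); [right|left].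
  have -> : pr A = 1 by rewrite /prob muA.
  lra.
(* This is [3 (2 q)^s]: the 3 is from [light_cover], the rest compares [2^(-n s)] with [d^s] when
   [d] exceeds [1 / (q 2^(n+1))]. *)
pose K : R := 3 * expR (s * (ln q%:R + ln 2)).
have K3 : 3 <= K.
  rewrite ler_peMr // -[X in X <= _]expR0 ler_expR mulr_ge0 // addr_ge0 //.
    by rewrite ln_ge0 // ler1n.
  exact: ltW.
apply: (@mass_distribution R mu A s K (freq n1)^-1 G mG) Hs => //.
- by move=> x [].
- by rewrite invr_gt0.
- move=> U hU e e0.
  have local n : (n1 <= n)%N -> (diam U <= ((freq n)^-1)%:E)%E ->
      exists C, [/\ measurable C, U `&` G `<=` C & pr C <= 3 * tau n].
    move=> n1n hd; have [C [mC UC prC]] := light_cover (ltW (tau0 n)) hd.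
    exists C; split=> // x [Ux [_ nB]]; apply: UC; split=> // hx.
    by apply: nB; exists (n - n1)%N => //; rewrite subnKC.
  have [U0|U0] := eqVneq U set0.
    exists set0; split; [exact: measurable0|by rewrite U0 set0I|].
    by rewrite measure0 adde_ge0 ?mule_ge0 ?hcontent_ge0 ?lee_fin //; lra.
  have [d dE] : exists d, diam U = d%:E.
    have : diam U \is a fin_num by rewrite ge0_fin_numE ?diam_ge0 // (le_lt_trans hU) // ltry.
    by move=> /fineK <-; eexists.
  have d0 : 0 <= d by rewrite -lee_fin -dE diam_ge0.
  have hcE : hcontent s U = (d `^ s)%:E.
    by rewrite /hcontent asboolF ?dE //; apply/eqP.
  (* A set of diameter zero fits every scale, so [n] can be taken so large that its mass bound drops
     below [e]. *)
  have [dz|dnz] := eqVneq d 0.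
    have tau_cvg : exists2 n, (n1 <= n)%N & 3 * tau n <= e.
      have th0 : 0 < t * ln 2 by rewrite mulr_gt0 //; lra.
      pose b := Num.bound `|- ln (e / 3) / (t * ln 2)|.
      exists (n1 + b)%N; first exact: leq_addr.
      have e3 : 0 < e / 3 by rewrite divr_gt0.
      suff : tau (n1 + b)%N <= e / 3 by lra.
      rewrite -[e / 3]lnK ?posrE // ler_expR.
      have : - ln (e / 3) / (t * ln 2) <= (n1 + b)%:R.
        apply: le_trans (ler_norm _) _; apply: le_trans (ltW (archi_boundP (normr_ge0 _))) _.
        by rewrite ler_nat leq_addl.
      by rewrite ler_pdivrMr //; lra.
    have [n n1n taun] := tau_cvg.
    have [|C [mC UC prC]] := local n n1n.
      by rewrite dE dz lee_fin invr_ge0 ltW.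
    exists C; split=> //; rewrite (@prE R mu) // -[(pr C)%:E]add0e.
    apply: leeD; first by rewrite mule_ge0 ?hcontent_ge0 ?lee_fin //; lra.
    by rewrite lee_fin; apply: le_trans prC _.
  have dgt0 : 0 < d by rewrite lt_neqAle eq_sym dnz.
  have [|n [n1n dn nd]] := @dyadic_scale n1 d.
    by rewrite dgt0 -lee_fin -dE.
  have [|C [mC UC prC]] := local n n1n; first by rewrite dE lee_fin.
  exists C; split=> //; rewrite (@prE R mu) // hcE -EFinM -EFinD lee_fin.
  apply: le_trans prC _; apply: le_trans (_ : K * d `^ s <= _); last by rewrite lerDl ltW.
  rewrite /K -mulrA ler_wpM2l // /powR (negPf dnz) /tau -expRD ler_expR.
  have : ln (freq n.+1)^-1 <= ln d by rewrite ler_ln ?posrE ?invr_gt0 // ltW.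
  rewrite lnV ?posrE // lnM ?posrE ?exprn_gt0 // lnXn // => hln.
  have h5 : s * (- (ln q%:R + n.+1%:R * ln 2)) <= s * ln d.
    by apply: ler_wpM2l => //; move: hln; rewrite -[ln 2 *+ _]mulr_natl.
  have h6 : n%:R * (s * ln 2) <= n%:R * (t * ln 2).
    by apply: ler_wpM2l => //; apply: ler_wpM2r; exact: ltW.
  by move: h5; rewrite -natr1; lra.
- by lra.
Qed.

End lower.

(** * Upper bound for the dimension *)

Section null.
Variable R : realType.

(** Points of [A] are covered at infinitely many levels, so the levels from [m] on already form a
    cover, with fine mesh and geometrically small content. *)
Lemma hausdorff_null (s C th : R) (A : set R) (V : nat -> nat -> set R) :
  0 <= C -> 0 < th < 1 ->
  (forall k, (\sum_(0 <= j <oo) hcontent s (V k j) <= (C * th ^+ k)%:E)%E) ->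
  (forall k j, (diam (V k j) <= (2^-1 ^+ k)%:E)%E) ->
  (forall m, A `<=` \bigcup_k \bigcup_j V (m + k)%N j) ->
  hausdorff_measure s A = 0%E.
Proof.
move=> C0 th01 Vs Vd AV; have [th0 th1] := andP th01.
have delta_ge0 d : (0 <= hausdorff_delta s d A)%E.
  apply: le_ereal_inf_tmp => _ [U _ <-]; apply: nneseries_ge0 => n _ _.
  exact: hcontent_ge0.
apply/eqP; rewrite eq_le; apply/andP; split; last first.
  by apply: le_ereal_sup_tmp; exists (hausdorff_delta s 1 A) => //; exists 1 => /=.
apply: ge_ereal_sup => _ [d /= d0 <-]; apply/lee_addgt0Pr => e e0; rewrite add0e.
have [m [md me]] : exists m, 2^-1 ^+ m <= d /\ C * th ^+ m / (1 - th) <= e.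
  have c1 : (fun m => 2^-1 ^+ m) @ \oo --> (0 : R).
    by apply: cvg_expr; rewrite ger0_norm ?invr_ge0 //; lra.
  have c2 : (fun m => C / (1 - th) * th ^+ m) @ \oo --> (0 : R).
    rewrite -(mulr0 (C / (1 - th))); apply: cvgMr; apply: cvg_expr.
    by rewrite ger0_norm // ltW.
  have h1 : \forall m \near \oo, 2^-1 ^+ m < d by apply: (cvgr_lt _ c1).
  have h2 : \forall m \near \oo, C / (1 - th) * th ^+ m < e by apply: (cvgr_lt _ c2).
  near \oo => m; exists m; split; first by apply: ltW; near: m.
  by rewrite mulrAC; apply: ltW; near: m.
(* A bijection from pairs to naturals flattens the doubly indexed cover into one sequence. *)
have [f] := ppcard_eqP card_nat2.
pose U j := V (m + (f^-1%FUN j).1)%N (f^-1%FUN j).2.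
apply: ge_ereal_inf; exists (\sum_(0 <= i <oo) hcontent s (U i))%E.
  exists U => //; split.
    move=> x /(AV m)[k _ [j _ Vx]]; exists (f (k, j)) => //.
    by rewrite /U funK ?inE.
  move=> i; apply: le_trans (Vd _ _) _; rewrite lee_fin; apply: le_trans md.
  by apply: ler_wiXn2l; [lra|lra|exact: leq_addr].
have hU i : (0 <= hcontent s (U i))%E by exact: hcontent_ge0.
rewrite nneseries_esumT // (@reindex_esum _ _ _ [set: nat * nat] setT f); last exact: 'bij_f.
have -> : \esum_(i in [set: nat * nat]) hcontent s (U (f i)) =
    \esum_(i in [set: nat]) \esum_(j in [set: nat]) hcontent s (V (m + i)%N j).
  rewrite (@esum_esum _ _ _ setT (fun=> setT) (fun i j => hcontent s (V (m + i)%N j))); last first.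
    by move=> i j _ _; exact: hcontent_ge0.
  rewrite (_ : setT `*`` _ = setT); last by apply/seteqP; split.
  by apply: eq_esum => i _; rewrite /U funK ?inE.
rewrite -nneseries_esumT; last first.
  by move=> i; apply: esum_ge0 => j _; exact: hcontent_ge0.
apply: (@le_trans _ _ (C * th ^+ m / (1 - th))%:E); last by rewrite lee_fin.
apply: geometric_eseries_le => //.
- by rewrite mulr_ge0 // exprn_ge0 // ltW.
- by move=> k; apply: esum_ge0 => j _; exact: hcontent_ge0.
- move=> k; rewrite -nneseries_esumT; last by move=> j; exact: hcontent_ge0.
  by rewrite -mulrA -exprD.
Unshelve. all: by end_near.
Qed.

Lemma diam_le (U : set R) (d : R) : 0 <= d ->
  (forall x y, U x -> U y -> `|x - y| <= d) -> (diam U <= d%:E)%E.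
Proof.
move=> d0 Ud; rewrite /diam; case: asboolP => _; first by rewrite lee_fin.
by apply: ge_ereal_sup => _ [[x y] [Ux Uy] <-]; rewrite lee_fin; exact: Ud.
Qed.

Lemma hcontent_le (U : set R) (s d : R) : 0 <= s -> (diam U <= d%:E)%E ->
  (hcontent s U <= (d `^ s)%:E)%E.
Proof.
move=> s0 Ud; rewrite /hcontent; case: asboolP => _; first by rewrite lee_fin powR_ge0.
have d0 := diam_ge0 U.
have : diam U \is a fin_num by rewrite ge0_fin_numE // (le_lt_trans Ud) // ltry.
move=> /fineK fE; move: d0 Ud; rewrite -fE !lee_fin => d0 Ud.
by rewrite ge0_ler_powR // ?nnegrE // (le_trans d0).
Qed.

End null.

(** * Dense residues and the upper bound *)

Section upper.
Variable R : realType.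
Variable mu : probability R R.
Local Notation pr := (prob mu).
Variables p q : nat.
Hypothesis pq : (p <= q)%N.
Hypothesis q_gt0 : (0 < q)%N.
Hypothesis hmu : self_similar_pq p q mu.
Local Notation gamma := (residue_count R (digits p q)).

Let qR : 0 < q%:R :> R. Proof. by rewrite ltr0n. Qed.

Local Notation freq n := (q%:R * 2 ^+ n : R).

Let freq_gt0 n : 0 < freq n.
Proof. by rewrite mulr_gt0 // exprn_gt0. Qed.

Lemma eq_gamma n j k : (2 ^+ n %| j - k)%Z -> gamma n j = gamma n k.
Proof.
move=> h; apply: eq_bigr => x _; rewrite -[LHS]indN -[RHS]indN.
rewrite (_ : - (x - j) = j + - x); last by ring.
by rewrite (_ : - (x - k) = k + - x) ?(ind_subst _ _ h) //; ring.
Qed.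

Section level.
Variables (n : nat) (sg : R).
Hypothesis sg0 : 0 < sg.

(* [sg ^+ 2 = 3 ^- n * tau] for a threshold [tau] on the mass [3 ^- n * gamma n j]. *)
Definition dense (j : int) : bool := 3 ^+ n * sg <= Num.sqrt (gamma n j).

Definition outside : set R := [set t | t < - 1 \/ 2 < t].

(** The range of [r] holds every value of the floor of [q t] for [t] in [[-1, 2]], that is, every
    offset between the grid index and the word value. *)
Definition sparse : set R := [set t | forall r : int, - q%:Z <= r <= 2 * q%:Z ->
  ~~ dense (Num.floor (freq n * t) - r)].

Definition typical : set R := ~` (outside `|` sparse).

Lemma measurable_outside : measurable outside.
Proof.
have -> : outside = `]-oo, - 1[%classic `|` `]2, +oo[%classic.
  by apply/seteqP; split=> t; rewrite /outside /= !in_itv /= andbT.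
by apply: measurableU.
Qed.

Lemma measurable_sparse : measurable sparse.
Proof.
exact: (@measurable_floor _ _ (fun k : int => forall r : int, - q%:Z <= r <= 2 * q%:Z ->
  ~~ dense (k - r)) (ltW (freq_gt0 n))).
Qed.

Lemma measurable_typical : measurable typical.
Proof.
apply: measurableC; apply: measurableU; [exact: measurable_outside|exact: measurable_sparse].
Qed.

Lemma eq_dense j k : (2 ^+ n %| j - k)%Z -> dense j = dense k.
Proof. by move=> h; rewrite /dense (eq_gamma h). Qed.

Let e3 : 0 < 3 ^+ n :> R. Proof. exact: exprn_gt0. Qed.

(** By self-similarity only words with a non-dense value contribute, and on those residues [gamma]
    is at most [3 ^+ n * sg] times its square root. *)
Lemma pr_typicalC : pr (~` typical) <= sg * root_sum R p q n.
Proof.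
rewrite setCK; apply: le_trans (pr_setU _ measurable_outside measurable_sparse) _.
rewrite (pr_support pq q_gt0 hmu) add0r.
rewrite (@pr_selfsim_floor _ mu p q q_gt0 hmu n (fun k : int => forall r : int, - q%:Z <= r <= 2 * q%:Z ->
  ~~ dense (k - r))).
apply: (@le_trans _ _ (3 ^- n * \sum_(x <- vals (digits p q) n) (~~ dense x)%:R)).
  apply: ler_wpM2l; first by rewrite invr_ge0 ltW.
  apply: ler_sum => x _.
  have mS : measurable [set t : R | forall r : int, - q%:Z <= r <= 2 * q%:Z ->
      ~~ dense (Num.floor (q%:R * t) + x - r)].
    exact: (@measurable_floor _ _ (fun k : int => forall r : int, - q%:Z <= r <= 2 * q%:Z ->
      ~~ dense (k + x - r)) (ltW qR)).
  case: (boolP (dense x)) => hx; last exact: pr_le1.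
  apply: (@le_trans _ _ (pr outside)); last by rewrite (pr_support pq q_gt0 hmu).
  apply: pr_le => //; first exact: measurable_outside.
  move=> t /= ht; apply: contrapT => hout.
  have [t1 t2] : - 1 <= t /\ t <= 2.
    by split; rewrite leNgt; apply/negP => h; apply: hout; [left|right].
  have fl : (- q%:Z <= Num.floor (q%:R * t) <= 2 * q%:Z).
    apply/andP; split.
      rewrite floor_ge_int rmorphN /= -pmulrn -[X in X <= _]mulr1 mulNr -mulrN.
      by apply: ler_wpM2l => //; exact: ltW.
    rewrite -ltzD1 floor_lt_int intrD intrM -pmulrn mulrC.
    by apply: le_lt_trans (ler_wpM2r (ltW qR) t2) _; rewrite ltrDl.
  by move: (ht _ fl); rewrite addrAC subrr add0r hx.
have -> : \sum_(x <- vals (digits p q) n) (~~ dense x)%:R =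
    \sum_(j < 2 ^ n) (~~ dense j%:Z)%:R * gamma n j%:Z :> R.
  under [RHS]eq_bigr => j _ do rewrite /residue_count mulr_sumr.
  rewrite exchange_big; apply: eq_bigr => x _ /=.
  rewrite -[LHS]mulr1 -(sum_ind R n x) mulr_sumr; apply: eq_bigr => j _.
  rewrite /pow2_dvd; case: (boolP (_ %| _)%Z) => h; last by rewrite !mulr0.
  by rewrite (eq_dense h).
rewrite /root_sum !mulr_sumr; apply: ler_sum => j _.
have g0 := gamma_ge0 R (digits p q) n j%:Z.
rewrite /dense -ltNge; case: ltP => h; last by rewrite mul0r mulr0 mulr_ge0 ?sqrtr_ge0 // ltW.
rewrite mul1r mulrC ler_pdivrMr // -{1}(sqr_sqrtr g0) expr2 mulrAC mulrC.
by rewrite [sg * _]mulrC ler_wpM2r ?sqrtr_ge0 // ltW // mulrC.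
Qed.

(* Index [i] encodes [i %% 2 ^ n] and a translation by [b * 2 ^ n + r] with
   [|b| <= 3 q] and [- q <= r <= 2 q]. *)
Definition boxes : nat := (6 * q + 1) * (3 * q + 1).

Definition box (i : nat) : set R :=
  let l := (i %/ 2 ^ n)%N in
  if (l < boxes)%N && dense (i %% 2 ^ n)%N then
    [set t | Num.floor (freq n * t) = (i %% 2 ^ n)%N%:Z
       + ((l %% (6 * q + 1))%N%:Z - 3 * q%:Z) * 2 ^+ n + ((l %/ (6 * q + 1))%N%:Z - q%:Z)]
  else set0.

Lemma typical_box : typical `<=` \bigcup_i box i.
Proof.
move=> t ht.
have [t1 t2] : - 1 <= t /\ t <= 2.
  by split; rewrite leNgt; apply/negP => h; apply: ht; left; [left|right].
have [r rq hd] : exists2 r : int, - q%:Z <= r <= 2 * q%:Z &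
    dense (Num.floor (freq n * t) - r).
  apply: contrapT => H; apply: ht; right => r rq; apply/negP => hd.
  by apply: H; exists r.
set f := Num.floor _ in hd.
have N0 : 0 < 2 ^+ n :> int by rewrite exprn_gt0.
have f1 : - q%:Z * 2 ^+ n <= f.
  rewrite floor_ge_int rmorphM rmorphN /= rmorphXn /= -pmulrn.
  by rewrite mulNr -mulrN1; apply: ler_wpM2l => //; exact: ltW.
have f2 : f <= 2 * q%:Z * 2 ^+ n.
  rewrite -ltzD1 floor_lt_int intrD !intrM rmorphXn /= -pmulrn.
  have := ler_wpM2l (ltW (freq_gt0 n)) t2; lra.
pose y := f - r; pose j := (y %% 2 ^+ n)%Z; pose b := (y %/ 2 ^+ n)%Z.
have yE : y = b * 2 ^+ n + j by exact: divz_eq.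
have j0 : 0 <= j by rewrite modz_ge0 // gt_eqF.
have jN : j < 2 ^+ n by exact: ltz_pmod.
(* The index [f] lies between [-q 2^n] and [2 q 2^n] and [r] shifts it by at most [2 q]; the bound
   [3 q] covers both. *)
have b1 : - (3 * q%:Z) <= b by move: rq f1; rewrite /y in yE; nia.
have b2 : b <= 3 * q%:Z by move: rq f2; rewrite /y in yE; nia.
have b0 : (0 < 6 * q + 1)%N by rewrite addn1.
have e2 : (0 < 2 ^ n)%N by rewrite expn_gt0.
have [b' b'E] : exists b' : nat, b'%:Z = b + 3 * q%:Z.
  by exists (absz (b + 3 * q%:Z)); rewrite gez0_abs //; lia.
have [r' r'E] : exists r' : nat, r'%:Z = r + q%:Z.
  by exists (absz (r + q%:Z)); rewrite gez0_abs //; lia.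
have [j' j'E] : exists j' : nat, j'%:Z = j by exists (absz j); rewrite gez0_abs.
have lb : (b' < 6 * q + 1)%N by lia.
have lr : (r' < 3 * q + 1)%N by lia.
have jN' : (j' < 2 ^ n)%N by rewrite -ltz_nat Posz_exp2 j'E.
exists (j' + (b' + r' * (6 * q + 1)) * 2 ^ n)%N => //; rewrite /box [(j' + _)%N]addnC.
rewrite divnMDl // [(j' %/ _)%N]divn_small // addn0 modnMDl [(j' %% _)%N]modn_small //.
have -> : (b' + r' * (6 * q + 1) < boxes)%N by rewrite /boxes; nia.
rewrite (_ : dense j'%:Z) /=; last first.
  by rewrite j'E -(eq_dense (j := y)) // -eqz_mod_dvd /j modz_mod.
rewrite [(b' + _)%N]addnC divnMDl // modnMDl [(b' %/ _)%N]divn_small // addn0 [(b' %% _)%N]modn_small //.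
rewrite -/f j'E b'E r'E.
by move: yE; rewrite /y => yE; rewrite -[f](subrK r) yE; ring.
Qed.

Lemma diam_box i : (diam (box i) <= ((2 ^+ n)^-1)%:E)%E.
Proof.
have e2 : 0 < 2 ^+ n :> R by exact: exprn_gt0.
apply: diam_le => [|x y]; first by rewrite invr_ge0 ltW.
rewrite /box; case: ifP => // _ /= <- hxy.
have hx := floor_itv (freq n * x); have hy := floor_itv (freq n * y).
rewrite hxy in hy; move: hx hy; rewrite intrD => /andP[x1 x2] /andP[y1 y2].
apply: (@le_trans _ _ (freq n)^-1).
  rewrite -(ler_pM2l (freq_gt0 n)) divff ?gt_eqF // -{1}(gtr0_norm (freq_gt0 n)) -normrM.
  by rewrite mulrBr ler_norml; lra.
rewrite lef_pV2 ?posrE //; apply: ler_peMl; first exact: ltW.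
by rewrite ler1n.
Qed.

(** A dense residue costs [tau = 3 ^+ n * sg ^+ 2], at most [sg] times the root of its count, so
    [root_sum] controls the content as well as the atypical mass. *)
Lemma sum_box (s tau : R) : 0 <= s -> tau = 3 ^+ n * sg ^+ 2 ->
  ((2 ^+ n)^-1) `^ s = tau ->
  (\sum_(0 <= i <oo) hcontent s (box i) <= (boxes%:R * (sg * root_sum R p q n))%:E)%E.
Proof.
move=> s0 tauE htau.
have box0 i : (boxes * 2 ^ n <= i)%N -> box i = set0.
  move=> hi; rewrite /box ltnNge (_ : (boxes <= _)%N) //.
  by rewrite leq_divRL // expn_gt0.
rewrite (@nneseries_split _ _ 0 (boxes * 2 ^ n)%N); last by move=> k _; exact: hcontent_ge0.
rewrite add0n [X in (_ + X)%E]eseries0 ?adde0; last first.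
  by move=> i hi _; rewrite box0 // /hcontent asboolT.
apply: (@le_trans _ _ (\sum_(0 <= i < boxes * 2 ^ n) ((dense (i %% 2 ^ n)%N)%:R * tau)%:E)%E).
  apply: lee_sum => i _; rewrite /box.
  case: (boolP (dense _)) => hd; last by rewrite andbF /hcontent asboolT // mul0r.
  rewrite mul1r -htau; have := diam_box i; rewrite /box hd.
  exact: hcontent_le.
rewrite sumEFin lee_fin big_mkord (big_ord_mul _ _ (fun i => (dense (i %% 2 ^ n)%N)%:R * tau)).
have -> : boxes%:R * (sg * root_sum R p q n) = \sum_(l < boxes) (sg * root_sum R p q n).
  by rewrite sumr_const card_ord mulr_natl.
apply: ler_sum => l _; rewrite /root_sum mulr_sumr; apply: ler_sum => j _.
rewrite addnC modnMDl modn_small //.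
case: (boolP (dense _)) => hd; last by rewrite mul0r mulr_ge0 ?sqrtr_ge0 // ltW.
rewrite mul1r tauE expr2 mulrA mulrC; apply: ler_wpM2l => //; exact: ltW.
Qed.

End level.

Lemma measure_dim_lt1 : (measure_dim mu < 1%E)%E.
Proof.
have [L L0 [lam /andP[lam0 lam1] root]] := root_sum_decay R pq.
have l2 : 0 < ln 2 :> R by rewrite ln_gt0 // ltr1n.
have LR : 0 < L%:R :> R by rewrite ltr0n.
have lnlam : ln lam < 0 by rewrite ln_lt0 // lam0.
(* Small enough that [th ^+ 2], which is [lam ^+ 2] times [2^(L u)], is at most [lam]; the cap 1/2
   keeps [s] nonnegative. *)
pose u := Num.min (1 / 2) (- ln lam / (L%:R * ln 2)).
have u0 : 0 < u.
  by rewrite /u lt_min divr_gt0 //= divr_gt0 ?mulr_gt0 // oppr_gt0.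
have u1 : u <= 1 / 2 by rewrite /u ge_min lexx.
have u2 : u * (L%:R * ln 2) <= - ln lam.
  by rewrite -ler_pdivlMr ?mulr_gt0 // /u ge_min lexx orbT.
pose s := 1 - u.
have s0 : 0 <= s by rewrite /s; lra.
pose w : R := expR (- (L%:R * (s * ln 2))).
have w0 : 0 < w by exact: expR_gt0.
pose sg k := Num.sqrt (w / 3 ^+ L) ^+ k.
have sg0 k : 0 < sg k by rewrite exprn_gt0 // sqrtr_gt0 divr_gt0 ?exprn_gt0.
pose th := lam * Num.sqrt (w * 2 ^+ L).
have th0 : 0 < th by rewrite mulr_gt0 // sqrtr_gt0 mulr_gt0 ?exprn_gt0.
have th1 : th < 1.
  rewrite -(@ltr_pXn2r _ 2) ?nnegrE ?ltW // expr1n exprMn sqr_sqrtr; last first.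
    by rewrite mulr_ge0 ?ltW ?exprn_gt0.
  have -> : 2 ^+ L = expR (L%:R * ln 2) :> R by rewrite expRM_natl lnK // posrE.
  have -> : lam ^+ 2 = expR (2%:R * ln lam) by rewrite expRM_natl lnK // posrE.
  rewrite -!expRD expR_lt1 /s.
  by move: u2 lnlam; lra.
have e6 : w / 3 ^+ L * 6 ^+ L = w * 2 ^+ L.
  have -> : 6 ^+ L = 3 ^+ L * 2 ^+ L :> R by rewrite -exprMn; congr (_ ^+ _); ring.
  by rewrite mulrA divfK // gt_eqF // exprn_gt0.
have sgroot k : sg k * root_sum R p q (k * L) <= th ^+ k.
  apply: le_trans (ler_wpM2l (ltW (sg0 k)) (root k)) _.
  have -> : th = Num.sqrt (w / 3 ^+ L) * (lam * Num.sqrt (6 ^+ L)).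
    by rewrite mulrCA -sqrtrM ?e6 // divr_ge0 ?exprn_ge0 // ltW.
  by rewrite -exprMn.
pose A_ k := typical (k * L) (sg k).
have mA_ k : measurable (A_ k) by exact: measurable_typical.
(* The upper limit [A] of the typical sets has full mass: the complement of each [B m] lies in
   atypical sets of arbitrarily small mass. *)
pose B m := \bigcup_k A_ (m + k)%N.
have mB m : measurable (B m) by apply: bigcup_measurable => k _.
pose A := \bigcap_m B m.
have mA : measurable A by apply: bigcapT_measurable.
have prB m : mu (~` B m) = 0%E.
  rewrite prE; last exact: measurableC.
  congr EFin; apply/eqP; rewrite eq_le pr_ge0 andbT.
  apply/ler_addgt0Pr => e e0; rewrite add0r.
  have c1 : (fun k => th ^+ k) @ \oo --> (0 : R).
    by apply: cvg_expr; rewrite ger0_norm // ltW.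
  have : \forall k \near \oo, th ^+ k < e by apply: (cvgr_lt _ c1).
  move=> [k _ /(_ (m + k)%N (leq_addl _ _)) /= hk].
  apply: le_trans (ltW hk); apply: le_trans (sgroot _).
  apply: le_trans (pr_typicalC _ (sg0 _)).
  apply: pr_le; [exact: measurableC|exact: (measurableC (mA_ (m + k)%N))|].
  by apply: subsetC => t ht; exists k.
have muA : mu A = 1%E.
  have mC : measurable (~` A) by exact: measurableC.
  have : mu (~` A) = 0%E.
    apply/eqP; rewrite eq_le measure_ge0 andbT.
    have AC : ~` A `<=` \bigcup_m ~` B m by rewrite /A setC_bigcap.
    apply: le_trans (measure_sigma_subadditive mu (fun m => measurableC (mB m)) mC AC) _.
    by rewrite eseries0 // => m _ _; exact: prB.
  rewrite prE // => -[]; rewrite pr_setC // => h.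
  by rewrite prE //; congr EFin; lra.
apply: (@le_lt_trans _ _ s%:E); last by rewrite lte_fin /s; lra.
apply: ge_ereal_inf; exists (hausdorff_dim A); first by exists A.
apply: ge_ereal_inf; exists s%:E => //; exists s => //; split=> //.
apply: (@hausdorff_null R s boxes%:R th A (fun k => box (k * L) (sg k))) => //.
- by rewrite th0.
- move=> k; apply: le_trans (sum_box (sg0 k) s0 erefl _) _; last first.
    by rewrite lee_fin ler_wpM2l.
  rewrite /powR gt_eqF ?invr_gt0 ?exprn_gt0 // lnV ?posrE ?exprn_gt0 // lnXn //.
  rewrite /sg exprAC sqr_sqrtr; last by rewrite divr_ge0 ?exprn_ge0 // ltW.
  rewrite mulnC exprM -exprMn [3 ^+ L * _]mulrC divfK ?gt_eqF ?exprn_gt0 //.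
  rewrite /w -expRM_natl; congr expR.
  by rewrite -[ln 2 *+ _]mulr_natl natrM; ring.
- move=> k j; apply: le_trans (diam_box _ _ _) _; rewrite lee_fin.
  rewrite exprVn lef_pV2 ?posrE ?exprn_gt0 //.
  by rewrite ler_eXn2l ?ltr1n // leq_pmulr.
- move=> m t /(_ m I)[k _ ht]; exists k => //; exact: typical_box.
Qed.

End upper.

Unset Implicit Arguments.
Set Strict Implicit.
Set Printing Implicit Defensive.

(* theta = atan (p/q); mu is mu_theta (characterised by self-similarity) *)
Theorem theorem4p4 (R : realType) (p q : nat)
  (hpq : coprime p q) (hle : (p <= q)%N)
  (mu : probability R R) (hmu : self_similar_pq p q mu) :
  (measure_dim mu < 1%E)%E /\
  (((ln 9 - pressure R p q) / ln 2)%:E <= measure_dim mu)%E.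
Proof.
(* If [q = 0] then [p = 0] as well, and 0 is not coprime to itself. *)
have q0 : (0 < q)%N.
  by case: q hpq hle {hmu} => // + /[!leqn0] /eqP p0; rewrite p0.
by split; [exact: measure_dim_lt1 hle q0 hmu|exact: measure_dim_ge hpq q0 hmu].
Qed.
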